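(* Let $X$ be a measure space, $\varphi\colon X\to X$ an automorphism and $\Gamma$ and $\Lambda$ $\mathrm{L}^1(X)$-normed modules. For an operator $\mathcal{T}\in\mathscr{L}(\Gamma,\Lambda)$ the following are equivalent. (a) $\mathcal{T}(fs)=T_\varphi f\cdot\mathcal{T}s$ for all $f\in\mathrm{L}^\infty(X)$ and every $s\in\Gamma$. (b) $|\mathcal{T}s|\le\|\mathcal{T}\|\cdot T_\varphi|s|$ for every $s\in\Gamma$. (c) There is an $m>0$ such that $|\mathcal{T}s|\le m\cdot T_\varphi|s|$ for every $s\in\Gamma$. Moreover, if $\Gamma=\Gamma^1(E)$ and $\Lambda=\Gamma^1(F)$ for measurable Banach bundles $E$ and $F$ over $X$ with $E$ separable, then (a)–(c) are also equivalent to the following assertion. (d) There is a morphism $\Phi\colon E\to F$ over $\varphi$ such that $\mathcal{T}=\mathcal{T}_\Phi$. If (d) holds, then the morphism $\Phi$ in (d) is unique, $$|\Phi|\colon\Omega_X\to[0,\infty),\quad x\mapsto\|\Phi_x\|$$ (where $\Phi_x=\Phi|_{E_x}$) defines an element of $\mathrm{L}^\infty(X)$, and - $\sup\{|\mathcal{T}_\Phi s| : s\in\Gamma^\infty(E)\text{ with }|s|\le\mathbf{1}\}=T_\varphi|\Phi|\in\mathrm{L}^\infty(X)$ (supremum in the lattice $\mathrm{L}^\infty(X)$), - $\|\Phi\|=\|\mathcal{T}_\Phi\|_{\Gamma^\infty(E)}=\|\mathcal{T}_\Phi\|_{\Gamma^1(E)}$, - $\Phi$ is an isometry if and only if $\mathcal{T}_\Phi\in\mathscr{L}(\Gamma^1(E),\Gamma^1(F))$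 is an isometry.
   Context: All vector spaces are over a fixed field $\mathbb{K}\in\{\mathbb{R},\mathbb{C}\}$; $\mathscr{L}$ denotes bounded linear maps. A measure space $X=(\Omega_X,\Sigma_X,\mu_X)$ is always $\sigma$-finite and complete. Morphisms of measure spaces are measurable measure-preserving maps modulo equality almost everywhere; an automorphism is an invertible morphism $X\to X$. Representatives are chosen whenever necessary. $T_\varphi f=f\circ\varphi^{-1}$ for $f\in\mathrm{L}^\infty(X)$ or $f\in\mathrm{L}^1(X)$. Banach module over $\mathrm{L}^\infty(X)$: a Banach space $\Gamma$ that is an $\mathrm{L}^\infty(X)$-module with $\|fs\|\le\|f\|\|s\|$, always assumed non-degenerate ($\Gamma=\overline{\mathrm{lin}}\{fs\}$, equivalently unitary). An $\mathrm{L}^1(X)$-normed module is a Banach module $\Gamma$ over $\mathrm{L}^\infty(X)$ together with a map $|\cdot|\colon\Gamma\to\mathrm{L}^\infty(X)'_+$ such that $\||s|\|=\|s\|$, $|fs|=|f|\cdot|s|$, $|s_1+s_2|\le|s_1|+|s_2|$ for all $s,s_1,s_2\in\Gamma$, $f\in\mathrm{L}^\infty(X)$, and such that $|s|$ lies in the canonical image of $\mathrm{L}^1(X)$ in $\mathrm{L}^\infty(X)'$ for every $s$ (so $|\cdot|$ is regarded as a map $\Gamma\to\mathrm{L}^1(X)_+$). Measurable Banach bundle over $X$: a triple $(E,p_E,\mathcal{M}_E)$ with $E$ a set, $p_E\colon E\to\Omega_X$ surjective, each fiber $E_x=p_E^{-1}(x)$ a Banach space, and $\mathcal{M}_E$ a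 linear subspace of the space $\mathcal{S}_E$ of all sections ($s\colon\Omega_X\to E$ with $p_E\circ s=\mathrm{id}$) such that (i) $fs\in\mathcal{M}_E$ for measurable $f\colon\Omega_X\to\mathbb{K}$ and $s\in\mathcal{M}_E$; (ii) $|s|\colon x\mapsto\|s(x)\|_{E_x}$ is measurable for $s\in\mathcal{M}_E$; (iii) if $(s_n)$ in $\mathcal{M}_E$ converges almost everywhere to $s\in\mathcal{S}_E$, then $s\in\mathcal{M}_E$. It is separable if there is a sequence $(s_n)$ in $\mathcal{M}_E$ with $\mathrm{lin}\{s_n(x):n\in\mathbb{N}\}$ dense in $E_x$ for almost every $x$. $\Gamma^1(E)$ (resp. $\Gamma^\infty(E)$) is the space of $s\in\mathcal{M}_E$ with $|s|$ integrable (resp. essentially bounded), modulo sections vanishing almost everywhere, with norm $\||s|\|_{\mathrm{L}^1}$ (resp. $\||s|\|_{\mathrm{L}^\infty}$) and pointwise multiplication by $\mathrm{L}^\infty(X)$; $\Gamma^1(E)$ is an $\mathrm{L}^1(X)$-normed module with $|s|=\|s(\cdot)\|$. A premorphism from $E$ to $F$ over $\varphi$ is a map $\Phi\colon E\to F$ such that (i) for every $s\in\mathcal{M}_E$ there is $t\in\mathcal{M}_F$ with $\Phi\circ s=t\circ\varphi$ almost everywhere; (ii) $p_F\circ\Phi=\varphi\circ p_E$ almost everywhere (i.e. on $E_x$ for almost every $x$); (iii) $\Phi|_{E_x}\in\mathscr{L}(E_x,F_{\varphi(x)})$ for almost every $x$; (iv) $\|\Phi\|:=\mathrm{ess\,sup}_x\|\Phi|_{E_x}\|<\infty$.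 A morphism over $\varphi$ is an equivalence class of premorphisms over $\varphi$, two being identified if they agree on $E_x$ for almost every $x$. It is an isometry (isometric) if $\Phi|_{E_x}$ is isometric for almost every $x$. $\mathcal{T}_\Phi s=\Phi\circ s\circ\varphi^{-1}$ defines operators in $\mathscr{L}(\Gamma^1(E),\Gamma^1(F))$ and $\mathscr{L}(\Gamma^\infty(E),\Gamma^\infty(F))$, whose operator norms are denoted $\|\mathcal{T}_\Phi\|_{\Gamma^1(E)}$ and $\|\mathcal{T}_\Phi\|_{\Gamma^\infty(E)}$. *)

(* Defs.v *)
From HB Require Import structures.
From mathcomp Require Import all_boot all_order all_algebra.
From mathcomp Require Import complex generic_quotient ring_quotient lra.
From mathcomp Require Import all_classical all_reals all_analysis ess_sup_inf measurable_realfun.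

Set Implicit Arguments.
Unset Strict Implicit.
Unset Printing Implicit Defensive.

Import Order.TTheory GRing.Theory Num.Theory.
Import numFieldNormedType.Exports.

Local Open Scope quotient_scope.
Local Open Scope classical_set_scope.
Local Open Scope ring_scope.

Inductive scalar_kind := real_scalars | complex_scalars.

Section scalars.
Variable R : realType.

Definition scalars (k : scalar_kind) : numFieldType :=
  match k with real_scalars => R | complex_scalars => R[i]%C end.

Definition to_real k : scalars k -> R :=
  match k with real_scalars => id | complex_scalars => @complex.Re R end.

Definition of_real k : R -> scalars k :=
  match k with real_scalars => id | complex_scalars => real_complex R end.

Lemma of_realK k : cancel (@of_real k) (@to_real k).
Proof. by case: k. Qed.

Lemma to_realK k (z : scalars k) : 0 <= z -> of_real k (to_real z) = z.
Proof.
case: k z => //= -[a b]; rewrite lecE /= => /andP[/eqP -> _] //.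
Qed.

Lemma of_real_le k x y : (of_real k x <= of_real k y) = (x <= y).
Proof. by case: k => //=; rewrite lecR. Qed.

Lemma of_real_lt k x y : (of_real k x < of_real k y) = (x < y).
Proof. by case: k => //=; rewrite ltcR. Qed.

Lemma of_realD k x y : of_real k (x + y) = of_real k x + of_real k y.
Proof. by case: k => //=; rewrite rmorphD. Qed.

Lemma of_realM k x y : of_real k (x * y) = of_real k x * of_real k y.
Proof. by case: k => //=; rewrite rmorphM. Qed.

Lemma of_real0 k : of_real k 0 = 0.
Proof. by case: k. Qed.

Lemma of_real1 k : of_real k 1 = 1.
Proof. by case: k. Qed.

(* The library's norm on a normed module over [K] takes its values in [K];
   [nrm] is the same norm with values in [R]. *)
Definition nrm k (V : normedZmodType (scalars k)) (v : V) : R := to_real `|v|.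

Section nrm_theory.
Variables (k : scalar_kind).

Lemma nrmE (V : normedZmodType (scalars k)) (v : V) : `|v| = of_real k (nrm v).
Proof. by rewrite /nrm to_realK. Qed.

Lemma nrm_ge0 (V : normedZmodType (scalars k)) (v : V) : 0 <= nrm v.
Proof. by rewrite -(of_real_le k) of_real0 -nrmE. Qed.

Lemma nrmD (V : normedZmodType (scalars k)) (v w : V) :
  nrm (v + w) <= nrm v + nrm w.
Proof. by rewrite -(of_real_le k) of_realD -!nrmE ler_normD. Qed.

Lemma nrm0 (V : normedZmodType (scalars k)) : nrm (0 : V) = 0.
Proof. by rewrite /nrm normr0 -(of_real0 k) of_realK. Qed.

Lemma nrm0_eq0 (V : normedZmodType (scalars k)) (v : V) : nrm v = 0 -> v = 0.
Proof. by move=> v0; apply/normr0_eq0; rewrite nrmE v0 of_real0. Qed.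

Lemma nrmB (V : normedZmodType (scalars k)) (v w : V) : nrm (v - w) = nrm (w - v).
Proof. by rewrite /nrm distrC. Qed.

Lemma nrmZ (V : normedModType (scalars k)) (a : scalars k) (v : V) :
  nrm (a *: v) = nrm a * nrm v.
Proof.
by rewrite /nrm normrZ -[LHS](of_realK k) !nrmE -of_realM !of_realK.
Qed.

End nrm_theory.

End scalars.

Section measure_space.
Context {R : realType} {k : scalar_kind}.
Local Notation K := (scalars R k).
Context {d : measure_display} {X : measurableType d}.
Variable mu : {measure set X -> \bar R}.

(* A representative of the automorphism and one of its inverse. *)
Record automorphism := Automorphism {
  aut :> X -> X ;
  aut_inv : X -> X ;
  aut_measurable : measurable_fun [set: X] aut ;
  aut_inv_measurable : measurable_fun [set: X] aut_inv ;
  aut_preserving : forall A, measurable A -> mu (aut @^-1` A) = mu A ;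
  aut_inv_preserving : forall A, measurable A -> mu (aut_inv @^-1` A) = mu A ;
  autK : \forall x \ae mu, aut_inv (aut x) = x ;
  aut_invK : \forall x \ae mu, aut (aut_inv x) = x }.

Definition koopman (phi : automorphism) (Y : Type) (f : X -> Y) : X -> Y :=
  f \o aut_inv phi.

Definition Kmeasurable (f : X -> K) : Prop :=
  forall U : set K, open U -> measurable (f @^-1` U).

(* Elements of L^1 and L^oo are handled through representatives; every notion
   below is invariant under equality almost everywhere. *)
Definition Linf (f : X -> K) : Prop :=
  Kmeasurable f /\ (fun x => nrm (f x)) \in Lfun mu +oo%E.

(* ['N[mu]_+oo[g]] is the essential supremum of [`|g|], and 0 if [mu] is zero. *)
Definition Linf_norm (f : X -> K) : R :=
  fine ('N[mu]_+oo[EFin \o (fun x => nrm (f x))])%E.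

(* [bm_act f] is only meaningful for [f] in L^oo. The module is unitary
   ([bm_act1]), which for Banach modules is the same as non-degenerate. *)
Record banach_module := BanachModule {
  bm_space :> completeNormedModType K ;
  bm_act : (X -> K) -> bm_space -> bm_space ;
  bm_act_ae : forall f g s, Linf f -> Linf g ->
    (\forall x \ae mu, f x = g x) -> bm_act f s = bm_act g s ;
  bm_actDl : forall f g s, Linf f -> Linf g ->
    bm_act (fun x => f x + g x) s = bm_act f s + bm_act g s ;
  bm_actZl : forall a f s, Linf f ->
    bm_act (fun x => a * f x) s = a *: bm_act f s ;
  bm_actDr : forall f s t, Linf f ->
    bm_act f (s + t) = bm_act f s + bm_act f t ;
  bm_actZr : forall f a s, Linf f -> bm_act f (a *: s) = a *: bm_act f s ;
  bm_actA : forall f g s, Linf f -> Linf g ->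
    bm_act (fun x => f x * g x) s = bm_act f (bm_act g s) ;
  bm_act1 : forall s, bm_act (fun=> 1) s = s ;
  bm_act_norm : forall f s, Linf f ->
    nrm (bm_act f s) <= Linf_norm f * nrm s }.

(* [lm_abs s] represents [|s|] in the positive cone of L^1. *)
Record L1_module := L1Module {
  lm_module :> banach_module ;
  lm_abs : lm_module -> X -> R ;
  lm_abs_L1 : forall s, lm_abs s \in Lfun mu 1 ;
  lm_abs_ge0 : forall s, \forall x \ae mu, 0 <= lm_abs s x ;
  lm_abs_norm : forall s, ('N[mu]_1[EFin \o lm_abs s] = (nrm s)%:E)%E ;
  lm_absM : forall f s, Linf f ->
    \forall x \ae mu, lm_abs (bm_act f s) x = nrm (f x) * lm_abs s x ;
  lm_absD : forall s t,
    \forall x \ae mu, lm_abs (s + t) x <= lm_abs s x + lm_abs t x }.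

(* The total space is [{x : X & fiber x}], with [projT1] as projection. *)
Record bundle := Bundle {
  fiber : X -> completeNormedModType K ;
  msec : set (forall x, fiber x) ;
  msec0 : msec (fun=> 0) ;
  msecD : forall s t, msec s -> msec t -> msec (fun x => s x + t x) ;
  msecZ : forall (a : K) s, msec s -> msec (fun x => a *: s x) ;
  msecM : forall (f : X -> K) s, Kmeasurable f -> msec s ->
    msec (fun x => f x *: s x) ;
  msec_norm : forall s, msec s -> measurable_fun [set: X] (fun x => nrm (s x)) ;
  msec_lim : forall (s_ : nat -> forall x, fiber x) (s : forall x, fiber x),
    (forall n, msec (s_ n)) ->
    (\forall x \ae mu, s_ n x @[n --> \oo] --> s x) -> msec s }.

Definition total (E : bundle) := {x : X & fiber E x}.

Definition tnrm (E : bundle) (e : total E) : R := nrm (projT2 e).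

Definition lin_span (V : lmodType K) (v_ : nat -> V) : set V :=
  [set v | exists n (c : nat -> K), v = \sum_(i < n) c i *: v_ i].

Definition separable_bundle (E : bundle) : Prop :=
  exists s_ : nat -> forall x, fiber E x, (forall n, msec (s_ n)) /\
    \forall x \ae mu, dense (lin_span (fun n => s_ n x)).

End measure_space.

Section Lnorm_monotone.
Context {R : realType} {d : measure_display} {X : measurableType d}.
Variable mu : {measure set X -> \bar R}.
Implicit Types f g : X -> R.

Lemma le_Lnorm p f g : (1 <= p)%E ->
  measurable_fun [set: X] f -> measurable_fun [set: X] g ->
  (\forall x \ae mu, `|f x| <= `|g x|) ->
  ('N[mu]_p[EFin \o f] <= 'N[mu]_p[EFin \o g])%E.
Proof.
move=> p1 mf mg fg; rewrite unlock /Lnorm.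
case: p p1 => [r|_|//]; last first.
  case: ifPn => // _; apply: le_ess_sup.
  by apply: filterS fg => x /=; rewrite lee_fin.
rewrite lee_fin => r1.
have r0 : 0 <= r by exact: le_trans r1.
have mpow (h : X -> R) : measurable_fun [set: X] h ->
    measurable_fun [set: X] ((fun x => (`|(EFin \o h) x| `^ r)%E) : X -> \bar R).
  move=> mh; apply/measurable_EFinP => /=.
  apply: (@measurableT_comp _ _ _ _ _ _ (@powR R ^~ r)) => //.
  exact: measurableT_comp.
apply: gt0_ler_poweR.
- by rewrite invr_ge0.
- by rewrite in_itv/= leey integral_ge0// => *; rewrite poweR_ge0.
- by rewrite in_itv/= leey integral_ge0// => *; rewrite poweR_ge0.
apply: ae_ge0_le_integral => //.
- by move=> *; rewrite poweR_ge0.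
- exact: mpow.
- by move=> *; rewrite poweR_ge0.
- exact: mpow.
apply: filterS fg => x /= fgx _.
by rewrite lee_fin ge0_ler_powR// nnegrE.
Qed.

Lemma ae_eq_Lnorm p f g : (1 <= p)%E ->
  measurable_fun [set: X] f -> measurable_fun [set: X] g ->
  (\forall x \ae mu, f x = g x) ->
  'N[mu]_p[EFin \o f]%E = 'N[mu]_p[EFin \o g]%E.
Proof.
move=> p1 mf mg fg; apply/eqP; rewrite eq_le !le_Lnorm//;
  by apply: filterS fg => x ->.
Qed.

Lemma le_Lfun p f g : (1 <= p)%E -> measurable_fun [set: X] f ->
  (\forall x \ae mu, `|f x| <= `|g x|) -> g \in Lfun mu p -> f \in Lfun mu p.
Proof.
move=> p1 mf fg /andP[/[!inE]/= mg lg].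
apply/andP; split; rewrite inE//=.
by rewrite /finite_norm (le_lt_trans _ lg)// le_Lnorm.
Qed.

Lemma Lfun_measurable p f : f \in Lfun mu p -> measurable_fun [set: X] f.
Proof. by move=> /andP[/[!inE]]. Qed.

Lemma Lfun_fineK p f : f \in Lfun mu p ->
  (fine 'N[mu]_p[EFin \o f])%:E = 'N[mu]_p[EFin \o f]%E.
Proof.
move=> /andP[/[!inE]/= mf lf].
by rewrite fineK// fin_numElt (lt_le_trans ltNy0) ?Lnorm_ge0.
Qed.

Lemma LnormZ_ge0 p (p1 : (1 <= p)%E) f (a : R) : 0 <= a -> f \in Lfun mu p ->
  'N[mu]_p[EFin \o (fun x => (a * f x)%R)]%E = (a%:E * 'N[mu]_p[EFin \o f])%E.
Proof.
move=> a0 fP; have := LnormZ (Lfun_Sub p1 fP) a.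
by rewrite ger0_norm.
Qed.

Lemma Lfun_scaler p (p1 : (1 <= p)%E) f (a : R) : f \in Lfun mu p ->
  (fun x => a * f x) \in Lfun mu p.
Proof.
move=> fP; have [_] := Lfun_submod_closed mu p1.
move=> /(_ a f (cst 0) fP).
rewrite (_ : a *: f + cst 0 = (fun x => a * f x)); last first.
  by apply/funext => x; rewrite /GRing.add/= addr0.
by apply; have [] := Lfun_submod_closed mu p1.
Qed.

Lemma Lfun_add p (p1 : (1 <= p)%E) f g : f \in Lfun mu p -> g \in Lfun mu p ->
  (fun x => f x + g x) \in Lfun mu p.
Proof. by have [_ D] := Lfun_addr_closed mu p1; exact: D. Qed.

Lemma ae_mu0 (P : X -> Prop) : ~ (0 < mu [set: X])%E -> \forall x \ae mu, P x.
Proof.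
move=> mu0; exists [set: X]; split => //.
by apply/eqP; rewrite eq_le measure_ge0 andbT leNgt; apply/negP.
Qed.

Lemma ae_le_Lnormy f : f \in Lfun mu +oo%E ->
  \forall x \ae mu, `|f x| <= fine ('N[mu]_+oo[EFin \o f])%E.
Proof.
move=> fP; have [mu0|/negP mu0] := boolP (0 < mu [set: X])%E; last exact: ae_mu0.
have := ess_sup_ge mu (abse \o (EFin \o f)); apply: filterS => x /= h.
by rewrite -lee_fin Lfun_fineK// unlock/= mu0.
Qed.

End Lnorm_monotone.

Section section_spaces.
Context {R : realType} {k : scalar_kind}.
Local Notation K := (scalars R k).
Context {d : measure_display} {X : measurableType d}.
Variable mu : {measure set X -> \bar R}.
Local Notation bundle := (bundle (k := k) mu).

Definition sections (E : bundle) := forall x, fiber E x.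

Section sections_lmod.
Variable E : bundle.

HB.instance Definition _ := Choice.copy (sections E) (forall x, fiber E x).

Let add (s t : sections E) : sections E := fun x => s x + t x.
Let opp (s : sections E) : sections E := fun x => - s x.
Let zero : sections E := fun=> 0.
Let scale (a : K) (s : sections E) : sections E := fun x => a *: s x.

Fact sections_addA : associative add.
Proof. by move=> s t u; apply/functional_extensionality_dep => x; exact: addrA. Qed.
Fact sections_addC : commutative add.
Proof. by move=> s t; apply/functional_extensionality_dep => x; exact: addrC. Qed.
Fact sections_add0 : left_id zero add.
Proof. by move=> s; apply/functional_extensionality_dep => x; exact: add0r. Qed.
Fact sections_addN : left_inverse zero opp add.
Proof. by move=> s; apply/functional_extensionality_dep => x; exact: addNr. Qed.

HB.instance Definition _ := GRing.isZmodule.Build (sections E)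
  sections_addA sections_addC sections_add0 sections_addN.

Fact sections_scaleA a b s : scale a (scale b s) = scale (a * b) s.
Proof. by apply/functional_extensionality_dep => x; exact: scalerA. Qed.
Fact sections_scale1 : left_id 1 scale.
Proof. by move=> s; apply/functional_extensionality_dep => x; exact: scale1r. Qed.
Fact sections_scaleDr : right_distributive scale +%R.
Proof. by move=> a s t; apply/functional_extensionality_dep => x; exact: scalerDr. Qed.
Fact sections_scaleDl s : {morph scale^~ s : a b / a + b}.
Proof. by move=> a b; apply/functional_extensionality_dep => x; exact: scalerDl. Qed.

HB.instance Definition _ := GRing.Zmodule_isLmodule.Build K (sections E)
  sections_scaleA sections_scale1 sections_scaleDr sections_scaleDl.

End sections_lmod.

Definition snrm (E : bundle) (s : sections E) : X -> R := fun x => nrm (s x).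

Section Gamma.
Variables (p : \bar R) (p1 : (1 <= p)%E) (E : bundle).

Definition psec of (1 <= p)%E : {pred sections E} :=
  fun s => `[< msec s /\ snrm s \in Lfun mu p >].

Lemma psecP (s : sections E) :
  reflect (msec s /\ snrm s \in Lfun mu p) (s \in psec p1).
Proof. exact: asboolP. Qed.

Lemma psec_submod_closed : submod_closed (psec p1).
Proof.
split.
  apply/psecP; split; first exact: msec0.
  rewrite (_ : snrm 0 = cst 0); last by apply/funext => x; rewrite /snrm nrm0.
  by have [] := Lfun_submod_closed mu p1.
move=> a s t /psecP[ms ls] /psecP[mt lt].
have mst : msec (a *: s + t) by apply: msecD => //; exact: msecZ.
apply/psecP; split => //.
apply: (@le_Lfun _ _ _ mu p _ (fun x => nrm a * snrm s x + snrm t x)) => //.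
- exact: (msec_norm mst).
- apply/nearW => x; rewrite !ger0_norm ?nrm_ge0//.
    by rewrite (le_trans (nrmD _ _))// nrmZ.
  by rewrite addr_ge0 ?mulr_ge0 ?nrm_ge0.
- by apply: Lfun_add => //; exact: Lfun_scaler.
Qed.

HB.instance Definition _ :=
  GRing.isSubmodClosed.Build _ _ (psec p1) psec_submod_closed.

Record Lsec := LSec { lsec_val :> sections E ; _ : lsec_val \in psec p1 }.

HB.instance Definition _ := [isSub for lsec_val].
HB.instance Definition _ := [Choice of Lsec by <:].
HB.instance Definition _ := [SubChoice_isSubLmodule of Lsec by <:].

Definition null_sec : {pred Lsec} :=
  fun s => `[< \forall x \ae mu, (s : sections E) x = 0 >].

Lemma null_secP (s : Lsec) :
  reflect (\forall x \ae mu, (s : sections E) x = 0) (s \in null_sec).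
Proof. exact: asboolP. Qed.

Lemma null_sec_zmod_closed : zmod_closed null_sec.
Proof.
split; first by apply/null_secP/nearW.
move=> s t /null_secP s0 /null_secP t0; apply/null_secP.
by apply: filterS2 s0 t0 => x sx tx; rewrite /= /GRing.add/= sx add0r /GRing.opp/= tx oppr0.
Qed.

HB.instance Definition _ :=
  GRing.isZmodClosed.Build _ null_sec null_sec_zmod_closed.

(* The p-integrable measurable sections modulo those vanishing a.e. *)
Definition Gamma := Quotient.quot null_sec.

HB.instance Definition _ := GRing.Zmodule.on Gamma.
HB.instance Definition _ := EqQuotient.on Gamma.

Definition vsec (u : Gamma) : sections E := lsec_val (repr u).

(* The class of [s], or 0 if [s] is not a p-integrable measurable section. *)
Definition cls (s : sections E) : Gamma := \pi_Gamma (insubd 0 s).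

Lemma vsecP u : vsec u \in psec p1.
Proof. exact: valP (repr u). Qed.

Lemma pi_aeP (s t : Lsec) : (\forall x \ae mu, (s : sections E) x = (t : sections E) x) <->
  \pi_Gamma s = \pi_Gamma t.
Proof.
split.
  move=> st; apply/eqP; rewrite -Quotient.idealrBE; apply/null_secP.
  by apply: filterS st => x stx; rewrite /= /GRing.add/= stx addrN.
move/eqP; rewrite -Quotient.idealrBE => /null_secP; apply: filterS => x /=.
by move/eqP; rewrite /GRing.add/= subr_eq0 => /eqP.
Qed.

Lemma vsec_pi (s : Lsec) : \forall x \ae mu, vsec (\pi_Gamma s) x = (s : sections E) x.
Proof. by apply/pi_aeP; rewrite reprK. Qed.

Lemma vsec_cls s : s \in psec p1 -> \forall x \ae mu, vsec (cls s) x = s x.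
Proof.
move=> sP; rewrite /cls; have /(congr1 val) : insubd 0 s = LSec sP :> Lsec.
  by apply: val_inj; rewrite val_insubd sP.
by have := vsec_pi (insubd 0 s) => /[swap] /= -> .
Qed.

Lemma vsec_inj u v : (\forall x \ae mu, vsec u x = vsec v x) -> u = v.
Proof. by move=> uv; rewrite -[u]reprK -[v]reprK; apply/pi_aeP. Qed.

Lemma vsec0 : \forall x \ae mu, vsec 0 x = 0.
Proof.
have -> : 0 = \pi_Gamma 0 :> Gamma by rewrite !piE.
exact: vsec_pi.
Qed.

Lemma vsecD u v : \forall x \ae mu, vsec (u + v) x = vsec u x + vsec v x.
Proof.
have -> : u + v = \pi_Gamma (repr u + repr v).
  by rewrite -[in LHS](reprK u) -[in LHS](reprK v); exact/esym/Quotient.pi_add.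
exact: vsec_pi.
Qed.

Lemma vsecN u : \forall x \ae mu, vsec (- u) x = - vsec u x.
Proof.
have -> : - u = \pi_Gamma (- repr u).
  by rewrite -[in LHS](reprK u); exact/esym/Quotient.pi_opp.
exact: vsec_pi.
Qed.

Let scale (a : K) (u : Gamma) : Gamma := \pi_Gamma (a *: repr u).

Let vsec_scale a u : \forall x \ae mu, vsec (scale a u) x = a *: vsec u x.
Proof. exact: vsec_pi. Qed.

Fact Gamma_scaleA a b u : scale a (scale b u) = scale (a * b) u.
Proof.
apply: vsec_inj; move: (vsec_scale a (scale b u)) (vsec_scale b u) (vsec_scale (a * b) u).
by apply: filterS3 => x -> -> ->; rewrite scalerA.
Qed.
Fact Gamma_scale1 : left_id 1 scale.
Proof.
by move=> u; apply: vsec_inj; have := vsec_scale 1 u; apply: filterS => x ->; rewrite scale1r.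
Qed.
Fact Gamma_scaleDr : right_distributive scale +%R.
Proof.
move=> a u v; apply: vsec_inj; near=> x.
rewrite (near (vsec_scale a (u + v)) x _)// (near (vsecD u v) x _)//.
rewrite (near (vsecD (scale a u) (scale a v)) x _)//.
by rewrite (near (vsec_scale a u) x _)// (near (vsec_scale a v) x _)// scalerDr.
Unshelve. all: by end_near. Qed.
Fact Gamma_scaleDl u : {morph scale^~ u : a b / a + b}.
Proof.
move=> a b; apply: vsec_inj; near=> x.
rewrite (near (vsec_scale (a + b) u) x _)//.
rewrite (near (vsecD (scale a u) (scale b u)) x _)//.
by rewrite (near (vsec_scale a u) x _)// (near (vsec_scale b u) x _)// scalerDl.
Unshelve. all: by end_near. Qed.

HB.instance Definition _ := GRing.Zmodule_isLmodule.Build K Gamma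
  Gamma_scaleA Gamma_scale1 Gamma_scaleDr Gamma_scaleDl.

Lemma vsecZ a u : \forall x \ae mu, vsec (a *: u) x = a *: vsec u x.
Proof. exact: vsec_scale. Qed.

Definition Gamma_norm (u : Gamma) : R :=
  fine ('N[mu]_p[EFin \o snrm (vsec u)])%E.

Lemma vsec_meas u : msec (vsec u).
Proof. by have /psecP[] := vsecP u. Qed.

Lemma vsec_Lfun u : snrm (vsec u) \in Lfun mu p.
Proof. by have /psecP[] := vsecP u. Qed.

Lemma vsec_mfun u : measurable_fun [set: X] (snrm (vsec u)).
Proof. exact: (msec_norm (vsec_meas u)). Qed.

Lemma Gamma_normE u : (Gamma_norm u)%:E = 'N[mu]_p[EFin \o snrm (vsec u)]%E.
Proof. exact: Lfun_fineK (vsec_Lfun u). Qed.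

Let norm (u : Gamma) : K := of_real k (Gamma_norm u).

Fact Gamma_normD u v : norm (u + v) <= norm u + norm v.
Proof.
rewrite /norm -of_realD of_real_le -lee_fin EFinD !Gamma_normE.
apply: (@le_trans _ _
  ('N[mu]_p[EFin \o (fun x => (snrm (vsec u) x + snrm (vsec v) x)%R)])%E).
  apply: le_Lnorm => //.
  - exact: vsec_mfun.
  - by apply: measurable_funD; exact: vsec_mfun.
  apply: filterS (vsecD u v) => x uv; rewrite !ger0_norm ?addr_ge0 ?nrm_ge0//.
  by rewrite /snrm uv nrmD.
apply: (@eminkowski _ _ _ mu (snrm (vsec u)) (snrm (vsec v)) p) => //;
  exact: vsec_mfun.
Qed.

Fact Gamma_normZ a u : norm (a *: u) = `|a| * norm u.
Proof.
rewrite /norm nrmE -of_realM; congr of_real; apply: EFin_inj.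
rewrite EFinM !Gamma_normE -LnormZ_ge0 ?nrm_ge0 ?vsec_Lfun//.
apply: ae_eq_Lnorm => //.
- exact: vsec_mfun.
- by apply: measurable_funM => //; exact: vsec_mfun.
by apply: filterS (vsecZ a u) => x; rewrite /snrm => ->; rewrite nrmZ.
Qed.

Fact Gamma_norm0_eq0 u : norm u = 0 -> u = 0.
Proof.
rewrite /norm -(of_real0 R k) => /(can_inj (@of_realK R k)) u0.
apply: vsec_inj; have := vsec0.
have : (EFin \o snrm (vsec u) = \0 %[ae mu])%E.
  apply: (@Lnorm_eq0_eq0 _ _ _ mu _ p).
  - by apply/measurable_EFinP; exact: vsec_mfun.
  - exact: lt_le_trans p1.
  - by rewrite -Gamma_normE u0.
by apply: filterS2 => x /(_ I)[/nrm0_eq0 ->] ->.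
Qed.

HB.instance Definition _ := Lmodule_isNormed.Build K Gamma
  Gamma_normD Gamma_normZ Gamma_norm0_eq0.

Lemma nrm_Gamma (u : Gamma) : nrm u = Gamma_norm u.
Proof. by rewrite /nrm /Num.norm/= of_realK. Qed.

End Gamma.
End section_spaces.

Section Gamma1_complete.
Context {R : realType} {k : scalar_kind}.
Local Notation K := (scalars R k).
Context {d : measure_display} {X : measurableType d}.
Variable mu : {measure set X -> \bar R}.

Lemma half_pow_sum n : \sum_(0 <= i < n) (2 * 2^-1 ^+ i) <= 4 :> R.
Proof.
suff -> : \sum_(0 <= i < n) (2 * 2^-1 ^+ i) = 4 - 4 * 2^-1 ^+ n :> R.
  by rewrite gerBl mulr_ge0// exprn_ge0.
elim: n => [|n IH]; first by rewrite big_nil expr0 mulr1 subrr.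
rewrite big_nat_recr//= IH exprS; move: (_ ^+ n) => z; lra.
Qed.

(* A normed space is complete as soon as the sequences with geometrically
   decreasing increments converge. *)
Lemma complete_of_geometric (V : normedModType K) :
  (forall u : nat -> V, (forall n, nrm (u n.+1 - u n) <= 2 * 2^-1 ^+ n) ->
    exists v, forall n, nrm (v - u n) <= 4 * 2^-1 ^+ n) ->
  forall F : set_system V, ProperFilter F -> cauchy F -> cvg F.
Proof.
move=> H F FF /cauchyP Fc.
have pow_gt0 n : 0 < 2^-1 ^+ n :> R by rewrite exprn_gt0.
have ex n : exists x : V, F [set y | nrm (x - y) < 2^-1 ^+ n].
  have e0 : 0 < of_real k (2^-1 ^+ n : R) by rewrite -(of_real0 R k) of_real_lt.
  have [x Fx] := Fc _ e0; exists x; apply: filterS Fx => y.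
  by rewrite -ball_normE /= nrmE of_real_lt.
have [u uP] := choice ex.
have [n|v vP] := H u.
  have [y [/= y1 y2]] := filter_ex (filterI (uP n) (uP n.+1)).
  rewrite -(subrKA y) (le_trans (nrmD _ _))//.
  rewrite [leRHS]mulr_natl mulr2n lerD ?(ltW (lt_le_trans y2 _))//.
    by rewrite exprS ler_piMl ?ltW// invf_lt1// ltr1n.
  by rewrite nrmB ltW.
apply/cvg_ex; exists v; apply/cvgrPdist_lt => e e0.
have e0' : 0 < to_real e by rewrite -(of_real_lt k) of_real0 to_realK// ltW.
have [n nP] : exists n, 5 * 2^-1 ^+ n < to_real e.
  have : (2^-1 ^+ n : R) @[n --> \oo] --> (0 : R).
    by apply: cvg_expr; rewrite ger0_norm// invf_lt1// ltr1n.
  move/cvgrPdist_lt => /(_ (to_real e / 5)); rewrite divr_gt0// => /(_ isT).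
  case=> n _ /(_ n (leqnn n)) /=; rewrite sub0r normrN ger0_norm ?ltW// => h.
  by exists n; rewrite mulrC -ltr_pdivlMr.
apply: filterS (uP n) => y /= h.
rewrite nrmE -(to_realK (ltW e0)) of_real_lt (le_lt_trans _ nP)//.
rewrite -(subrKA (u n)) (le_trans (nrmD _ _))//.
have := vP n; move: h; move: (nrm _) (nrm _) (_ ^+ n) => a b c; lra.
Qed.

(* Pointwise convergence under summable increments. *)
Lemma summable_cvg (V : completeNormedModType K) (s : nat -> V) :
  (\sum_(0 <= i <oo) (nrm (s i.+1 - s i))%:E < +oo)%E -> cvgn s.
Proof.
set a := fun i => nrm (s i.+1 - s i) => sa.
have a0 i : 0 <= a i by exact: nrm_ge0.
have cA : cvgn (series a).
  apply: nondecreasing_is_cvgn.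
    by apply/nondecreasing_seqP => n; rewrite /series/= big_nat_recr//= lerDl.
  exists (fine (\sum_(0 <= i <oo) (a i)%:E)%E) => _ [n _ <-].
  rewrite -lee_fin fineK; last first.
    by rewrite ge0_fin_numE// nneseries_ge0// => *; rewrite lee_fin.
  rewrite /series/= -sumEFin.
  by apply: nneseries_lim_ge => *; rewrite lee_fin.
have sS i : series a i.+1 = series a i + a i.
  by rewrite /series/= big_nat_recr.
have tele n m : nrm (s (n + m)%N - s n) <= series a (n + m)%N - series a n.
  elim: m => [|m IH]; first by rewrite addn0 !subrr nrm0.
  rewrite addnS sS -(subrKA (s (n + m)%N)) (le_trans (nrmD _ _))//.
  by move: IH; rewrite -/(a (n + m)%N); lra.
apply: cauchy_cvg; apply/cauchyP => e e0.
have e0' : 0 < to_real e by rewrite -(of_real_lt k) of_real0 to_realK// ltW.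
have /cvgrPdist_lt /(_ _ e0') [N _ NP] := cA.
exists (s N); exists N => // n /= Nn.
rewrite -ball_normE /= nrmE -(to_realK (ltW e0)) of_real_lt nrmB.
rewrite -(subnKC Nn) (le_lt_trans (tele _ _))// (subnKC Nn).
have hn : series a n <= limn (series a).
  apply: nondecreasing_cvgn_le => //.
  by apply/nondecreasing_seqP => i; rewrite /series/= big_nat_recr//= lerDl.
have := NP N (leqnn N); rewrite /= => /(le_lt_trans (ler_norm _)).
by apply: le_lt_trans; rewrite lerD2r.
Qed.

Variable E : bundle (k := k) mu.
Local Notation G := (Gamma (@lexx _ _ 1%E) E).

Lemma Gamma1_normE (u : G) : (\int[mu]_x (snrm (vsec u) x)%:E)%E = (nrm u)%:E.
Proof.
rewrite nrm_Gamma Gamma_normE Lnorm1; apply: eq_integral => x _ /=.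
by rewrite ger0_norm// nrm_ge0.
Qed.

Lemma Gamma1_geometric (u : nat -> G) :
  (forall n, nrm (u n.+1 - u n) <= 2 * 2^-1 ^+ n) ->
  exists v, forall n, nrm (v - u n) <= 4 * 2^-1 ^+ n.
Proof.
move=> uP.
have msecB (s t : sections E) : msec s -> msec t -> msec (s - t).
  by move=> ms mt; rewrite -scaleN1r; apply: msecD => //; exact: msecZ.
pose g n x : \bar R := (snrm (vsec (u n.+1) - vsec (u n)) x)%:E.
have g0 n x : (0 <= g n x)%E by rewrite lee_fin nrm_ge0.
have mg n : measurable_fun [set: X] (g n).
  apply/measurable_EFinP; apply: (msec_norm (s := vsec (u n.+1) - vsec (u n))).
  by apply: msecB; exact: vsec_meas.
have mB (s : sections E) (v : G) :
    msec s -> measurable_fun [set: X] (fun x => (nrm (s x - vsec v x))%:E : \bar R).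
  move=> ms; apply/measurable_EFinP; apply: (msec_norm (s := s - vsec v)).
  by apply: msecB => //; exact: vsec_meas.
have vB (v w : G) : \forall x \ae mu, vsec (v - w) x = vsec v x - vsec w x.
  by apply: filterS2 (vsecD v (- w)) (vsecN w) => x -> ->.
have ig n : (\int[mu]_x g n x)%E = (nrm (u n.+1 - u n))%:E.
  rewrite -Gamma1_normE; apply: ge0_ae_eq_integral => //.
  - by apply/measurable_EFinP; exact: vsec_mfun.
  - by move=> x _; rewrite lee_fin nrm_ge0.
  - by apply: filterS (vB (u n.+1) (u n)) => x /= e _; rewrite /snrm e.
pose h n x := (\sum_(0 <= i <oo) g (n + i)%N x)%E.
have h0 n x : (0 <= h n x)%E by apply: nneseries_ge0.
have mh n : measurable_fun [set: X] (h n).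
  by apply: ge0_emeasurable_sum => //.
have ih n : (\int[mu]_x h n x <= (4 * 2^-1 ^+ n)%:E)%E.
  rewrite integral_nneseries//; apply: lime_le.
    by apply: is_cvg_nneseries => *; exact: integral_ge0.
  apply: nearW => m; rewrite (eq_bigr _ (fun i _ => ig (n + i)%N)) sumEFin lee_fin.
  apply: (@le_trans _ _ (\sum_(0 <= i < m) 2^-1 ^+ n * (2 * 2^-1 ^+ i))).
    apply: ler_sum => i _; apply: (le_trans (uP _)).
    by rewrite exprD mulrCA mulrA.
  by rewrite -mulr_sumr mulrC ler_wpM2r ?exprn_ge0// half_pow_sum.
have hfin n : \forall x \ae mu, (h n x < +oo)%E.
  have : mu.-integrable [set: X] (h n).
    apply/integrableP; split => //.
    under eq_integral do rewrite gee0_abs//.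
    by rewrite (le_lt_trans (ih n))// ltry.
  move=> /(integrable_ae measurableT); apply: filterS => x /(_ I).
  by rewrite ge0_fin_numE.
pose s x : nat -> fiber E x := fun n => vsec (u n) x.
pose t : sections E := fun x => limn (s x).
have st : \forall x \ae mu, s x n @[n --> \oo] --> t x.
  apply: filterS (hfin 0%N) => x hx.
  exact: (@summable_cvg _ (s x) hx).
have mt : msec t.
  apply: (@msec_lim _ _ _ _ _ E (fun n => vsec (u n))) => //.
  by move=> n; exact: vsec_meas.
have tail n : \forall x \ae mu, ((nrm (t x - vsec (u n) x))%:E <= h n x)%E.
  apply: filterS st => x stx.
  have part m : ((nrm (s x (n + m)%N - s x n))%:E <= h n x)%E.
    apply: (@le_trans _ _ (\sum_(0 <= i < m) g (n + i)%N x)%E); last first.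
      by apply: nneseries_lim_ge => *; exact: g0.
    elim: m => [|m IH]; first by rewrite addn0 subrr nrm0 big_nil.
    rewrite big_nat_recr//= addnS.
    apply: (le_trans _ (leeD IH (lexx _))).
    rewrite -EFinD lee_fin [leRHS]addrC.
    by rewrite -(subrKA (s x (n + m)%N)) (le_trans (nrmD _ _)).
  have [hfx|/negP] := boolP (h n x < +oo)%E; last first.
    by rewrite ltey => /negP /negPn /eqP ->; rewrite leey.
  rewrite -(@fineK _ (h n x)) ?ge0_fin_numE// lee_fin.
  apply/ler_addgt0Pr => e e0.
  have eK : 0 < of_real k e by rewrite -(of_real0 R k) of_real_lt.
  move/cvgrPdist_lt : stx => /(_ _ eK) [N _ /(_ (n + N)%N)].
  rewrite /= leq_addl => /(_ isT); rewrite nrmE of_real_lt => tN.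
  rewrite -(subrKA (s x (n + N)%N)) (le_trans (nrmD _ _))// [leRHS]addrC lerD//.
    exact: ltW.
  by rewrite -lee_fin fineK ?ge0_fin_numE.
have tB n : (\int[mu]_x (nrm (t x - vsec (u n) x))%:E <= (4 * 2^-1 ^+ n)%:E)%E.
  apply: le_trans (ih n); apply: ae_ge0_le_integral => //.
  - by move=> x _; rewrite lee_fin nrm_ge0.
  - exact: mB.
  - by apply: filterS (tail n) => x ? _.
have tP : t \in psec (@lexx _ _ 1%E).
  rewrite -(subrK (vsec (u 0%N)) t) rpredD ?vsecP//.
  have m0 : msec (t - vsec (u 0%N)) by apply: msecB => //; exact: vsec_meas.
  apply/psecP; split => //; apply/Lfun1_integrable/integrableP; split.
    by apply/measurable_EFinP; exact: msec_norm.
  under eq_integral => x _ do rewrite /= ger0_norm ?nrm_ge0//.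
  by rewrite (le_lt_trans (tB 0%N))// ltry.
exists (cls (@lexx _ _ 1%E) t) => n.
rewrite -lee_fin -Gamma1_normE (le_trans _ (tB n))//.
rewrite le_eqVlt; apply/orP; left; apply/eqP.
apply: ge0_ae_eq_integral => //.
- by apply/measurable_EFinP; exact: vsec_mfun.
- exact: mB.
- by move=> x _; rewrite lee_fin nrm_ge0.
- by move=> x _; rewrite lee_fin nrm_ge0.
by apply: filterS2 (vB (cls (@lexx _ _ 1%E) t) (u n)) (vsec_cls tP) => x /= e1 e2 _;
  rewrite /snrm e1 e2.
Qed.

End Gamma1_complete.

Section Gamma1_module.
Context {R : realType} {k : scalar_kind}.
Local Notation K := (scalars R k).
Context {d : measure_display} {X : measurableType d}.
Variable mu : {measure set X -> \bar R}.
Variable E : bundle (k := k) mu.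

Definition Gamma1 := Gamma (@lexx _ _ 1%E) E.
Definition Gammay := Gamma (@leey _ 1%E) E.

HB.instance Definition _ := NormedModule.on Gamma1.
HB.instance Definition _ := NormedModule.on Gammay.

Fact Gamma1_complete (F : set_system Gamma1) : ProperFilter F -> cauchy F -> cvg F.
Proof. by apply: complete_of_geometric; exact: Gamma1_geometric. Qed.

HB.instance Definition _ := Uniform_isComplete.Build Gamma1 Gamma1_complete.

Definition Gamma1_act (f : X -> K) (u : Gamma1) : Gamma1 :=
  cls _ (fun x => f x *: vsec u x).

Lemma Linf_scale_psec (f : X -> K) (s : sections E) : Linf mu f ->
  s \in psec (@lexx _ _ 1%E) ->
  ((fun x => f x *: s x) : sections E) \in psec (@lexx _ _ 1%E).
Proof.
move=> [mf lf] /psecP[ms ls].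
have mfs : msec (fun x => f x *: s x) by exact: msecM.
apply/psecP; split => //.
apply: (@le_Lfun _ _ _ mu _ _ (fun x => Linf_norm mu f * snrm s x)) => //.
- exact: (msec_norm mfs).
- apply: filterS (ae_le_Lnormy lf) => x hx.
  rewrite ger0_norm ?nrm_ge0// /snrm nrmZ.
  apply: (le_trans _ (ler_norm _)); rewrite ler_wpM2r ?nrm_ge0//.
  by rewrite (le_trans _ hx)// ler_norm.
- exact: Lfun_scaler.
Qed.

Lemma vsec_act f u : Linf mu f ->
  \forall x \ae mu, vsec (Gamma1_act f u) x = f x *: vsec u x.
Proof.
by move=> lf; apply: vsec_cls; apply: Linf_scale_psec => //; exact: vsecP.
Qed.

Fact Gamma1_act_ae f g u : Linf mu f -> Linf mu g ->
  (\forall x \ae mu, f x = g x) -> Gamma1_act f u = Gamma1_act g u.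
Proof.
move=> lf lg fg; apply: vsec_inj.
by apply: filterS3 fg (vsec_act u lf) (vsec_act u lg) => x + -> -> => ->.
Qed.

Fact Gamma1_actDl f g u : Linf mu f -> Linf mu g ->
  Gamma1_act (fun x => f x + g x) u = Gamma1_act f u + Gamma1_act g u.
Proof.
move=> lf lg; apply: vsec_inj.
have P : ((fun x => (f x + g x) *: vsec u x) : sections E) \in psec (@lexx _ _ 1%E).
  rewrite (_ : (fun _ => _) = ((fun x => f x *: vsec u x) : sections E) +
      ((fun x => g x *: vsec u x) : sections E)).
    by rewrite rpredD// Linf_scale_psec// vsecP.
  by apply/functional_extensionality_dep => x; exact: scalerDl.
near=> x.
rewrite (near (vsec_cls P) x _)// (near (vsecD (Gamma1_act f u) (Gamma1_act g u)) x _)//.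
by rewrite (near (vsec_act u lf) x _)// (near (vsec_act u lg) x _)// scalerDl.
Unshelve. all: by end_near. Qed.

Fact Gamma1_actZl a f u : Linf mu f ->
  Gamma1_act (fun x => a * f x) u = a *: Gamma1_act f u.
Proof.
move=> lf; apply: vsec_inj.
have P : ((fun x => (a * f x) *: vsec u x) : sections E) \in psec (@lexx _ _ 1%E).
  rewrite (_ : (fun _ => _) = a *: ((fun x => f x *: vsec u x) : sections E)).
    by rewrite rpredZ// Linf_scale_psec// vsecP.
  by apply/functional_extensionality_dep => x; rewrite -scalerA.
by apply: filterS3 (vsec_cls P) (vsecZ a (Gamma1_act f u)) (vsec_act u lf) =>
  x -> -> ->; rewrite scalerA.
Qed.

Fact Gamma1_actDr f u v : Linf mu f ->
  Gamma1_act f (u + v) = Gamma1_act f u + Gamma1_act f v.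
Proof.
move=> lf; apply: vsec_inj; near=> x.
rewrite (near (vsec_act (u + v) lf) x _)//.
rewrite (near (vsecD (Gamma1_act f u) (Gamma1_act f v)) x _)//.
rewrite (near (vsec_act u lf) x _)// (near (vsec_act v lf) x _)//.
by rewrite (near (vsecD u v) x _)// scalerDr.
Unshelve. all: by end_near. Qed.

Fact Gamma1_actZr f a u : Linf mu f ->
  Gamma1_act f (a *: u) = a *: Gamma1_act f u.
Proof.
move=> lf; apply: vsec_inj; near=> x.
rewrite (near (vsec_act (a *: u) lf) x _)//.
rewrite (near (vsecZ a (Gamma1_act f u)) x _)// (near (vsec_act u lf) x _)//.
by rewrite (near (vsecZ a u) x _)// !scalerA mulrC.
Unshelve. all: by end_near. Qed.

Fact Gamma1_actA f g u : Linf mu f -> Linf mu g ->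
  Gamma1_act (fun x => f x * g x) u = Gamma1_act f (Gamma1_act g u).
Proof.
move=> lf lg; apply: vsec_inj.
have P : ((fun x => (f x * g x) *: vsec u x) : sections E) \in psec (@lexx _ _ 1%E).
  rewrite (_ : (fun _ => _) =
      ((fun x => f x *: ((fun y => g y *: vsec u y) : sections E) x) : sections E)).
    by rewrite !Linf_scale_psec// vsecP.
  by apply/functional_extensionality_dep => x; rewrite scalerA.
by apply: filterS3 (vsec_cls P) (vsec_act (Gamma1_act g u) lf) (vsec_act u lg) =>
  x -> -> ->; rewrite scalerA.
Qed.

Fact Gamma1_act1 u : Gamma1_act (fun=> 1) u = u.
Proof.
rewrite /Gamma1_act (_ : (fun _ => _) = vsec u).
  by apply: vsec_inj; exact: vsec_cls (vsecP u).
by apply/functional_extensionality_dep => x; rewrite scale1r.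
Qed.

Fact Gamma1_act_norm f u : Linf mu f ->
  nrm (Gamma1_act f u) <= Linf_norm mu f * nrm u.
Proof.
move=> lf; have [_ nf] := lf.
have N0 : 0 <= Linf_norm mu f by rewrite fine_ge0// Lnorm_ge0.
rewrite -lee_fin EFinM -!Gamma1_normE -ge0_integralZl//; last 2 first.
- by apply/measurable_EFinP; exact: vsec_mfun.
- by move=> x _; rewrite lee_fin nrm_ge0.
apply: ae_ge0_le_integral => //.
- by move=> x _; rewrite lee_fin nrm_ge0.
- by apply/measurable_EFinP; exact: vsec_mfun.
- by move=> x _; rewrite -EFinM lee_fin mulr_ge0 ?nrm_ge0.
- by apply/measurable_EFinP; apply: measurable_funM => //; exact: vsec_mfun.
apply: filterS2 (vsec_act u lf) (ae_le_Lnormy nf) => x e h _.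
rewrite -EFinM lee_fin /snrm e nrmZ ler_wpM2r ?nrm_ge0//.
by rewrite (le_trans _ h)// ler_norm.
Qed.

Definition Gamma1_banach_module : banach_module (k := k) mu :=
  @BanachModule _ _ _ _ mu Gamma1 Gamma1_act Gamma1_act_ae Gamma1_actDl
    Gamma1_actZl Gamma1_actDr Gamma1_actZr Gamma1_actA Gamma1_act1
    Gamma1_act_norm.

Fact Gamma1_abs_ge0 (u : Gamma1_banach_module) :
  \forall x \ae mu, 0 <= snrm (vsec u) x.
Proof. by apply: nearW => x; exact: nrm_ge0. Qed.

Fact Gamma1_abs_norm (u : Gamma1_banach_module) :
  ('N[mu]_1[EFin \o snrm (vsec u)] = (nrm u)%:E)%E.
Proof. by rewrite nrm_Gamma Gamma_normE. Qed.

Fact Gamma1_absM f (u : Gamma1_banach_module) : Linf mu f ->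
  \forall x \ae mu, snrm (vsec (bm_act f u)) x = nrm (f x) * snrm (vsec u) x.
Proof. by move=> lf; apply: filterS (vsec_act u lf) => x; rewrite /snrm => ->; rewrite nrmZ. Qed.

Fact Gamma1_absD (u v : Gamma1_banach_module) :
  \forall x \ae mu, snrm (vsec (u + v)) x <= snrm (vsec u) x + snrm (vsec v) x.
Proof. by apply: filterS (vsecD u v) => x; rewrite /snrm => ->; exact: nrmD. Qed.

Definition Gamma1_module : L1_module (k := k) mu :=
  @L1Module _ _ _ _ mu Gamma1_banach_module (fun u => snrm (vsec u))
    (@vsec_Lfun _ _ _ _ _ _ _ _) Gamma1_abs_ge0 Gamma1_abs_norm
    Gamma1_absM Gamma1_absD.

End Gamma1_module.

Section operators.
Context {R : realType} {k : scalar_kind}.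
Local Notation K := (scalars R k).
Context {d : measure_display} {X : measurableType d}.
Variable mu : {measure set X -> \bar R}.
Local Notation bundle := (bundle (k := k) mu).
Variable phi : automorphism mu.

Lemma ae_aut_inv (P : X -> Prop) :
  (\forall x \ae mu, P x) -> \forall y \ae mu, P (aut_inv phi y).
Proof.
move=> [N [mN N0 PN]]; exists (aut_inv phi @^-1` N); split.
- by rewrite -[X in measurable X]setTI; exact: aut_inv_measurable.
- by rewrite aut_inv_preserving.
- by move=> y Py; exact: PN.
Qed.

Lemma Lfun_koopman p (f : X -> R) : (1 <= p)%E ->
  f \in Lfun mu p -> koopman phi f \in Lfun mu p.
Proof.
move=> p1 /andP[/[!inE]/= mf lf].
have mk : measurable_fun [set: X] (koopman phi f).
  by apply: measurableT_comp => //; exact: aut_inv_measurable.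
apply/andP; split; rewrite inE//=; apply: le_lt_trans lf.
rewrite unlock /Lnorm; case: p p1 => [r|_|//]; last first.
  by case: ifPn => // _; apply/ess_supP; exact: (ae_aut_inv (ess_sup_ge mu _)).
rewrite lee_fin => r1.
have mpow : measurable_fun [set: X] ((fun x => (`|(EFin \o f) x| `^ r)%E) : X -> \bar R).
  apply/measurable_EFinP => /=.
  apply: (@measurableT_comp _ _ _ _ _ _ (@powR R ^~ r)) => //.
  exact: measurableT_comp.
rewrite le_eqVlt; apply/orP; left; apply/eqP; congr (_ `^ _)%E.
pose mx := isMeasurableFun.Build _ _ _ _ _ (aut_inv_measurable phi).
pose psi : {mfun X >-> X} := HB.pack (aut_inv phi) mx.
transitivity (\int[pushforward mu psi]_x (`|(EFin \o f) x| `^ r))%E; last first.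
  by apply: eq_measure_integral => A mA _; rewrite -[RHS](aut_inv_preserving phi mA).
rewrite ge0_integral_pushforward//.
by move=> y _; exact: poweR_ge0.
Qed.

Definition opnorm (V W : normedModType K) (T : V -> W) : \bar R :=
  ereal_sup [set (nrm (T v))%:E | v in [set v | nrm v <= 1]].

Section L1_module_operators.
Variables G L : L1_module (k := k) mu.
Variable T : G -> L.

Definition koopman_linear : Prop := forall (f : X -> K) (s : G), Linf mu f ->
  T (bm_act f s) = bm_act (koopman phi f) (T s).

Definition koopman_opnorm_dominated : Prop := forall s : G, \forall x \ae mu,
  ((lm_abs (T s) x)%:E <= opnorm T * (koopman phi (lm_abs s) x)%:E)%E.

Definition koopman_dominated : Prop := exists2 m : R, 0 < m &
  forall s : G, \forall x \ae mu, lm_abs (T s) x <= m * koopman phi (lm_abs s) x.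

End L1_module_operators.

Section morphisms.
Variables E F : bundle.
Implicit Type Phi : total E -> total F.

Definition fiber_norm Phi (x : X) : \bar R :=
  ereal_sup [set (tnrm (Phi (existT _ x v)))%:E
            | v in [set v : fiber E x | nrm v <= 1]].

Definition morph_norm Phi : \bar R := 'N[mu]_+oo[fiber_norm Phi]%E.

Definition morph_abs Phi (x : X) : R := fine (fiber_norm Phi x).

Definition premorphism Phi : Prop :=
  [/\ forall s : sections E, msec s -> exists2 t : sections F, msec t &
        \forall x \ae mu, Phi (existT _ x (s x)) = existT _ (phi x) (t (phi x)),
      \forall x \ae mu, forall v : fiber E x, projT1 (Phi (existT _ x v)) = phi x,
      \forall x \ae mu, exists L : {linear fiber E x -> fiber F (phi x)},
        continuous L /\ forall v, Phi (existT _ x v) = existT _ (phi x) (L v)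
    & (morph_norm Phi < +oo)%E].

Definition morph_eq Phi Phi' : Prop :=
  \forall x \ae mu, forall v : fiber E x, Phi (existT _ x v) = Phi' (existT _ x v).

Definition morph_isometric Phi : Prop :=
  \forall x \ae mu, forall v : fiber E x, tnrm (Phi (existT _ x v)) = nrm v.

(* [e] seen as an element of the fiber over [y], or 0 if it lies elsewhere. *)
Definition in_fiber (y : X) (e : total F) : fiber F y :=
  xget 0 [set w | existT _ y w = e].

Definition push_section Phi (s : sections E) : sections F := fun y =>
  in_fiber y (Phi (existT _ (aut_inv phi y) (s (aut_inv phi y)))).

(* The class of [Phi \o s \o phi^-1]; [morph_opP] shows that the default values
   in [cls] and [in_fiber] are irrelevant when [Phi] is a premorphism. *)
Definition morph_op p (p1 : (1 <= p)%E) Phi (u : Gamma p1 E) : Gamma p1 F :=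
  cls p1 (push_section Phi (vsec u)).

Definition morph_op1 Phi : Gamma1 E -> Gamma1 F := morph_op Phi.
Definition morph_opy Phi : Gammay E -> Gammay F := morph_op Phi.

Lemma in_fiberE (y : X) (w : fiber F y) : in_fiber y (existT _ y w) = w.
Proof.
rewrite /in_fiber; case: xgetP => [v _ /= vw|/(_ w) /(_ erefl) //].
exact: eq_from_Tagged vw.
Qed.

Section morph_op_theory.
Variable Phi : total E -> total F.
Hypothesis Phi_pre : premorphism Phi.

Lemma premorphism_le : \forall x \ae mu, forall v : fiber E x,
  tnrm (Phi (existT _ x v)) <= fine (morph_norm Phi) * nrm v.
Proof.
case: Phi_pre => _ _ lin fin.
have [mu0|/negP mu0] := boolP (0 < mu [set: X])%E; last exact: ae_mu0.
have N0 : (0 <= morph_norm Phi)%E by exact: Lnorm_ge0.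
have bound : \forall x \ae mu, (`|fiber_norm Phi x| <= morph_norm Phi)%E.
  by rewrite /morph_norm unlock mu0; exact: ess_sup_ge.
apply: filterS2 lin bound => x [L [_ LE]] bx v.
have [v0|v0] := eqVneq (nrm v) 0.
  rewrite (nrm0_eq0 v0) LE linear0 /tnrm/= !nrm0 mulr0.
  by [].
have vp : 0 < nrm v by rewrite lt_neqAle eq_sym v0 nrm_ge0.
rewrite LE /tnrm/= -ler_pdivrMr// -lee_fin fineK ?ge0_fin_numE//.
apply: le_trans (le_trans (lee_abs _) bx).
apply: ereal_sup_ubound; exists (of_real k (nrm v)^-1 *: v).
  by rewrite /= nrmZ /nrm ger0_norm ?of_realK ?mulVf// -(of_real0 R k) of_real_le invr_ge0 ltW.
rewrite LE /tnrm/= linearZ/= nrmZ mulrC; congr (_ * _)%:E.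
by rewrite /nrm ger0_norm ?of_realK// -(of_real0 R k) of_real_le invr_ge0 ltW.
Qed.

Lemma push_sectionP (s : sections E) : msec s -> \forall y \ae mu,
  existT (fiber F) y (push_section Phi s y) =
  Phi (existT _ (aut_inv phi y) (s (aut_inv phi y))).
Proof.
case: Phi_pre => + _ _ _ => /[apply] -[t _ /ae_aut_inv].
apply: filterS2 (aut_invK phi) => y; rewrite /push_section => yK ->.
by rewrite yK in_fiberE.
Qed.

Lemma push_section_psec p (p1 : (1 <= p)%E) (s : sections E) :
  s \in psec p1 -> push_section Phi s \in psec p1.
Proof.
move=> /psecP[ms ls]; have ps := push_sectionP ms.
have mps : msec (push_section Phi s).
  case: Phi_pre => /(_ s ms)[t mt /ae_aut_inv st] _ _ _.
  apply: (@msec_lim _ _ _ _ _ F (fun=> t)) => //.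
  apply: filterS2 (aut_invK phi) st => y yK; rewrite /push_section => ->.
  by rewrite yK in_fiberE; exact: cvg_cst.
apply/psecP; split => //.
apply: (@le_Lfun _ _ _ mu _ _
  (fun y => fine (morph_norm Phi) * koopman phi (snrm s) y)) => //.
- exact: (msec_norm mps).
- apply: filterS2 ps (ae_aut_inv premorphism_le) => y psy h.
  rewrite ger0_norm ?nrm_ge0// (le_trans _ (ler_norm _))//.
  by rewrite (le_trans _ (h _))// -psy.
- by apply: Lfun_scaler => //; exact: Lfun_koopman.
Qed.

Lemma morph_opP p (p1 : (1 <= p)%E) (u : Gamma p1 E) : \forall y \ae mu,
  existT (fiber F) y (vsec (morph_op Phi u) y) =
  Phi (existT _ (aut_inv phi y) (vsec u (aut_inv phi y))).
Proof.
have uP := vsecP u; have := vsec_cls (push_section_psec uP).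
apply: filterS2 (push_sectionP (vsec_meas u)) => y <-.
by rewrite /morph_op => ->.
Qed.

End morph_op_theory.

End morphisms.

Definition isometric (V W : normedModType K) (T : V -> W) : Prop :=
  forall v, `|T v| = `|v|.

Definition Linf_lub (A : set (X -> R)) (g : X -> R) : Prop :=
  [/\ g \in Lfun mu +oo%E,
      forall f, A f -> \forall x \ae mu, f x <= g x
    & forall h, h \in Lfun mu +oo%E ->
        (forall f, A f -> \forall x \ae mu, f x <= h x) ->
        \forall x \ae mu, g x <= h x].

End operators.

(* Main.v *)
Require Import Defs.
From HB Require Import structures.
From mathcomp Require Import all_boot all_order all_algebra.
From mathcomp Require Import complex lra.
From mathcomp Require Import all_classical all_reals all_analysis ess_sup_inf measurable_realfun.
Set Implicit Arguments.
Unset Strict Implicit.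
Unset Printing Implicit Defensive.
Import Order.TTheory GRing.Theory Num.Theory.
Import numFieldNormedType.Exports.
Local Open Scope classical_set_scope.
Local Open Scope ring_scope.

(** Everything rests on two observations about an operator [T] between
    L^1-normed modules.

    If [T] intertwines the module structures along [phi], then for measurable
    [A] the integral of [|T s|] over [A] is the norm of
    [1_A T s = T (1_(phi^-1 A) s)], while the integral of [T_phi |s|] over [A]
    is the norm of [1_(phi^-1 A) s]. Hence a bound on norms becomes a bound on
    all integrals over measurable sets, that is, an inequality almost everywhere
    ([koopman_linear_le], and [koopman_linear_ge] for lower bounds).

    If conversely [|T s| <= m T_phi |s|] for every [s], then for each scalar [c]
    the element [D = T (f s) - (T_phi f) (T s)] does not change when [f] is
    replaced by [f - c], so [|D| <= 2 m |T_phi f - c| T_phi |s|]. Letting [c] run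
    through a countable dense set of scalars gives [D = 0]
    ([koopman_dominated_linear]).

    For bundles, separability provides a sequence [U n] of integrable sections
    whose values are dense in almost every fiber ([separable_dense_sequence]):
    the rational combinations of the given sections, rescaled to be integrable,
    which is possible by sigma-finiteness. For almost every [x] the domination
    inequality holds at [x] for all rational combinations of three of the [U n]
    at once, so [U n x |-> T (U n) (phi x)] extends to a bounded linear map
    between the fibers. The extension [L] is characterized by a condition, being
    the only map such that [L v = w] as soon as
    [nrm (w - T (U n) (phi x)) <= m * nrm (v - U n x)] for all [n]
    ([dense_linear_extension]). Since the domination inequality for [u - U n]
    is this very condition, [L (u x) = T u (phi x)] almost everywhere for
    each [u], and the measurability requirement on the morphism comes for free
    ([koopman_dominated_morphism]).

    The assertions about a given morphism [Phi] are then tested on the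
    sequence [U n]. A continuous linear map is determined by its values on a
    dense family, and so are its norm ([opnorm_dense]) and whether it is
    isometric. Thus [|Phi|] is almost everywhere a countable supremum of
    measurable functions, realized by the sections [U n] divided by their
    pointwise norms, which lie in the unit ball of L^oo sections; the
    equality with the L^1 operator norm follows from the almost everywhere
    inequality of the first observation. *)

(** * Scalars and norms *)

Section scalars_theory.
Context {R : realType} {k : scalar_kind}.
Local Notation K := (scalars R k).

Lemma nrm_of_real (r : R) : nrm (of_real k r : K) = `|r|.
Proof.
rewrite /nrm; case: k => //=.
by rewrite expr0n/= addr0 sqrtr_sqr.
Qed.

Lemma nrm1 : nrm (1 : K) = 1.
Proof. by rewrite -(of_real1 R k) nrm_of_real normr1. Qed.

Lemma nrmN (V : normedZmodType K) (v : V) : nrm (- v) = nrm v.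
Proof. by rewrite /nrm normrN. Qed.

Lemma ler_nrm_sub (V : normedZmodType K) (u v w : V) :
  nrm (u - w) <= nrm (u - v) + nrm (v - w).
Proof. by rewrite -(subrKA v) nrmD. Qed.

Lemma nrm_lerB (V : normedZmodType K) (u v : V) : nrm u <= nrm v + nrm (u - v).
Proof. by rewrite -[in leLHS](subrKC v u) nrmD. Qed.

(** Pairs of rationals index a dense family over either field, so that the
    linear combinations with such coefficients form one countable type. *)
Definition rational_scalar : rat * rat -> K :=
  match k as k' return rat * rat -> scalars R k' with
  | real_scalars => fun q => ratr q.1
  | complex_scalars => fun q => (ratr q.1 +i* ratr q.2)%C
  end.

Lemma rational_scalar_dense (z : K) (e : R) : 0 < e ->
  exists q, nrm (z - rational_scalar q) < e.
Proof.
have ratR (r e' : R) : 0 < e' -> exists q : rat, `|r - ratr q| < e'.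
  move=> e'0; have /rat_in_itvoo[q] : r - e' < r + e' by lra.
  by rewrite in_itv/= => /andP[h1 h2]; exists q; rewrite ltr_norml; lra.
rewrite /rational_scalar; case: k z => [z|[a b]] e0.
  by have [q qP] := ratR z e e0; exists (q, 0).
have e2 : 0 < e / 2 by lra.
have [[p pP] [q qP]] := (ratR a _ e2, ratR b _ e2).
exists (p, q); rewrite /nrm /=.
apply: (@le_lt_trans _ _ (`|a - ratr p| + `|b - ratr q|)); last by lra.
rewrite -ler_sqr ?nnegrE ?sqrtr_ge0 ?addr_ge0// sqr_sqrtr ?addr_ge0 ?sqr_ge0//.
rewrite -(real_normK (num_real (a - _))) -(real_normK (num_real (b - _))).
rewrite sqrrD lerD2r lerDl.
by rewrite mulrn_wge0// mulr_ge0.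
Qed.

Lemma dense_nrm (V : normedModType K) (S : set V) : dense S <->
  forall (v : V) (e : R), 0 < e -> exists2 w, S w & nrm (v - w) < e.
Proof.
split => [dS v e e0|dS O [v Ov] oO].
  have e0' : 0 < of_real k e by rewrite -(of_real0 R k) of_real_lt.
  have [||w [bw Sw]] := dS (ball v (of_real k e)).
  - by exists v; exact: ballxx.
  - exact: ball_open.
  by exists w => //; move: bw; rewrite -ball_normE/= nrmE of_real_lt.
have /nbhs_ballP[e/= e0 be] := open_nbhs_nbhs (conj oO Ov).
have e0' : 0 < to_real e by rewrite -(of_real_lt k) of_real0 to_realK// ltW.
have [w Sw vw] := dS v _ e0'; exists w; split => //; apply: be.
by rewrite -ball_normE/= nrmE -(to_realK (ltW e0)) of_real_lt.
Qed.

Lemma cvg_nrm (V : normedModType K) (u : nat -> V) (v : V) :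
  u n @[n --> \oo] --> v <->
  forall e : R, 0 < e -> exists N, forall n, (N <= n)%N -> nrm (v - u n) < e.
Proof.
split=> [/cvgrPdist_lt uv e e0|uv].
  have e0' : 0 < of_real k e by rewrite -(of_real0 R k) of_real_lt.
  have [N _ NP] := uv _ e0'; exists N => n /NP /=.
  by rewrite nrmE of_real_lt.
apply/cvgrPdist_lt => e e0.
have e0' : 0 < to_real e by rewrite -(of_real_lt k) of_real0 to_realK// ltW.
have [N NP] := uv _ e0'; exists N => // n /= /NP.
by rewrite nrmE -(of_real_lt k) (to_realK (ltW e0)).
Qed.

Lemma bounded_continuous (V W : normedModType K) (L : {linear V -> W}) (m : R) :
  (forall v, nrm (L v) <= m * nrm v) -> continuous L.
Proof.
move=> Lm v; apply/cvgrPdist_lt => e e0.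
have e0' : 0 < to_real e by rewrite -(of_real_lt k) of_real0 to_realK// ltW.
pose r := to_real e / (`|m| + 1).
have m0 : 0 < `|m| + 1 by rewrite ltr_wpDl.
have r0 : 0 < of_real k r by rewrite -(of_real0 R k) of_real_lt divr_gt0.
apply/nbhs_ballP; exists (of_real k r) => //= w.
rewrite -ball_normE/= nrmE of_real_lt => vw.
rewrite nrmE -(to_realK (ltW e0)) of_real_lt -linearB.
rewrite (le_lt_trans (Lm _))// (@le_lt_trans _ _ ((`|m| + 1) * nrm (v - w)))//.
  by rewrite ler_wpM2r ?nrm_ge0// (le_trans (ler_norm _))// lerDl.
by rewrite mulrC -ltr_pdivlMr.
Qed.

End scalars_theory.

(** * Bounded operators and extension from a dense family *)

Section normed_spaces.
Context {R : realType} {k : scalar_kind}.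
Local Notation K := (scalars R k).

Lemma opnorm_ubound (V W : normedModType K) (T : V -> W) v :
  nrm v <= 1 -> ((nrm (T v))%:E <= opnorm T)%E.
Proof. by move=> v1; apply: ereal_sup_ubound; exists v. Qed.

Lemma opnorm_le (V W : normedModType K) (T : V -> W) (m : R) : 0 <= m ->
  (forall v, nrm (T v) <= m * nrm v) -> (opnorm T <= m%:E)%E.
Proof.
move=> m0 Tm; apply: ge_ereal_sup => _ [v /= v1 <-].
by rewrite lee_fin (le_trans (Tm v))// ler_piMr.
Qed.

Lemma opnorm_ge0 (V W : normedModType K) (T : V -> W) : (0 <= opnorm T)%E.
Proof.
apply: le_trans (opnorm_ubound T (_ : nrm 0 <= 1)); first by rewrite lee_fin nrm_ge0.
by rewrite nrm0.
Qed.

Lemma opnorm_fin_num (V W : normedModType K) (T : {linear V -> W}) :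
  continuous T -> opnorm T \is a fin_num.
Proof.
move=> /linear_bounded_continuous/linear_boundedP/pinfty_ex_gt0[M M0 TM].
rewrite ge0_fin_numE ?opnorm_ge0//.
apply: le_lt_trans (ltry (to_real M)); apply: opnorm_le.
  by rewrite -(of_real_le k) of_real0 to_realK ltW.
move=> v; rewrite -(of_real_le k) of_realM -!nrmE to_realK ?(ltW M0)//.
Qed.

Lemma opnorm_bound (V W : normedModType K) (T : {linear V -> W}) v :
  continuous T -> nrm (T v) <= fine (opnorm T) * nrm v.
Proof.
move=> Tc; have [/nrm0_eq0 ->|v0] := eqVneq (nrm v) 0.
  by rewrite linear0 !nrm0 mulr0.
have vp : 0 < nrm v by rewrite lt_neqAle eq_sym v0 nrm_ge0.
rewrite -ler_pdivrMr// -lee_fin fineK ?opnorm_fin_num//.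
apply: le_trans (opnorm_ubound T (_ : nrm (of_real k (nrm v)^-1 *: v) <= 1)).
  by rewrite linearZ/= nrmZ nrm_of_real ger0_norm ?invr_ge0 ?nrm_ge0// mulrC.
by rewrite nrmZ nrm_of_real ger0_norm ?invr_ge0 ?nrm_ge0// mulVf.
Qed.

(** Both sides are continuous in the scalar, so an inequality between them passes
    from the rational scalars, which can be handled countably many at a time,
    to all scalars. *)
Lemma ler_rational_scalar (V W : normedModType K) (m : R) (v v' : V) (w w' : W) :
  0 <= m ->
  (forall q, nrm (rational_scalar q *: w + w') <=
             m * nrm (rational_scalar q *: v + v')) ->
  forall a : K, nrm (a *: w + w') <= m * nrm (a *: v + v').
Proof.
move=> m0 H a; apply/ler_addgt0Pr => e e0.
pose b := m * nrm v + nrm w.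
have b0 : 0 <= b by rewrite addr_ge0 ?mulr_ge0 ?nrm_ge0.
have b1 : 0 < b + 1 by rewrite ltr_wpDl.
have [q qP] := rational_scalar_dense a (divr_gt0 e0 b1).
set r := rational_scalar q in qP *.
have addDKr (U : zmodType) (x y z : U) : x + z - (y + z) = x - y.
  by rewrite opprD addrACA subrr addr0.
have hw : nrm (a *: w + w') <= nrm (r *: w + w') + nrm (a - r) * nrm w.
  by rewrite -nrmZ (le_trans (nrm_lerB _ (r *: w + w')))// addDKr -scalerBl.
have hv : nrm (r *: v + v') <= nrm (a *: v + v') + nrm (a - r) * nrm v.
  by rewrite nrmB -nrmZ (le_trans (nrm_lerB _ (a *: v + v')))// addDKr -scalerBl.
have hb : nrm (a - r) * b <= e.
  rewrite (@le_trans _ _ (nrm (a - r) * (b + 1)))//.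
    by rewrite ler_wpM2l ?nrm_ge0// lerDl.
  by rewrite -ler_pdivlMr// ltW.
have hm : m * nrm (r *: v + v') <= m * (nrm (a *: v + v') + nrm (a - r) * nrm v).
  by rewrite ler_wpM2l.
apply: (le_trans hw); apply: (le_trans (lerD (H q) (lexx _))).
rewrite -/r (le_trans (lerD hm (lexx _)))//.
rewrite mulrDr -addrA lerD2l (le_trans _ hb)// /b mulrDr.
by rewrite mulrCA.
Qed.

Section extension.
Variables (V : normedModType K) (W : completeNormedModType K) (I : Type).
Variables (p : I -> V) (q : I -> W) (m : R).
Hypothesis m0 : 0 <= m.
Hypothesis p_dense : dense (range p).
Hypothesis pq : forall (a : K) i j l,
  nrm (a *: q i + q j - q l) <= m * nrm (a *: p i + p j - p l).

(** The graph of the extension: at most one [w] satisfies it by density of the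
    [p i], and one exists by completeness of [W]. *)
Let ext (v : V) (w : W) := forall i, nrm (w - q i) <= m * nrm (v - p i).

Let near_p (v : V) e : 0 < e -> exists i, nrm (v - p i) < e.
Proof. by move=> e0; have /dense_nrm/(_ v e e0)[_ [i _ <-] ?] := p_dense; exists i. Qed.

Let pq_dist i j : nrm (q i - q j) <= m * nrm (p i - p j).
Proof. by have := pq 0 i i j; rewrite !scale0r !add0r. Qed.

Let ext_exists v : exists w, ext v w.
Proof.
have pow_gt0 n : 0 < 2^-1 ^+ n :> R by rewrite exprn_gt0.
have [i iP] := choice (fun n => near_p v (pow_gt0 n)).
have pow_small e : 0 < e -> exists N, forall n, (N <= n)%N -> m * 2^-1 ^+ n < e.
  move=> e0; have m1 : 0 < m + 1 by rewrite ltr_wpDl.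
  have : (2^-1 ^+ n : R) @[n --> \oo] --> (0 : R).
    by apply: cvg_expr; rewrite ger0_norm// invf_lt1// ltr1n.
  move/cvgrPdist_lt => /(_ (e / (m + 1))); rewrite divr_gt0// => /(_ isT).
  case=> N _ NP; exists N => n /NP /=; rewrite sub0r normrN ger0_norm ?ltW//.
  rewrite ltr_pdivlMr// mulrC; apply: le_lt_trans.
  by rewrite ler_wpM2r ?ltW// ltrDl.
have qd n l : nrm (q (i n) - q (i l)) <= m * 2^-1 ^+ n + m * 2^-1 ^+ l.
  rewrite (le_trans (pq_dist _ _))// -mulrDr ler_wpM2l//.
  by rewrite (le_trans (ler_nrm_sub _ v _))// nrmB lerD// ltW.
have : cvgn (q \o i).
  apply: cauchy_cvg; apply/cauchyP => e e0.
  have e0' : 0 < to_real e by rewrite -(of_real_lt k) of_real0 to_realK// ltW.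
  have [N NP] := pow_small (to_real e / 2) (divr_gt0 e0' (ltr0Sn _ 1)).
  exists (q (i N)); exists N => // n /= Nn.
  rewrite -ball_normE /= nrmE -(to_realK (ltW e0)) of_real_lt.
  rewrite (le_lt_trans (qd _ _))//.
  by have := NP _ Nn; have := NP _ (leqnn N); lra.
move/cvg_ex => [w /cvg_nrm wP]; exists w => j; apply/ler_addgt0Pr => e e0.
have e2 : 0 < e / 2 by rewrite divr_gt0.
have [[N NP] [M MP]] := (wP _ e2, pow_small _ e2).
have := NP _ (leq_maxl N M); have := MP _ (leq_maxr N M); set n := maxn N M => h1 h2.
have h3 : m * nrm (p (i n) - p j) <= m * 2^-1 ^+ n + m * nrm (v - p j).
  rewrite -mulrDr ler_wpM2l// (le_trans (ler_nrm_sub _ v _))// nrmB lerD2r.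
  exact: ltW.
apply: (le_trans (ler_nrm_sub _ (q (i n)) _)).
move: (pq_dist (i n) j) h1 h2 h3 => /=; lra.
Qed.

Let near_p2 e v v' : 0 < e -> exists i j, nrm (v - p i) < e /\ nrm (v' - p j) < e.
Proof.
by move=> e0; have [[i ?] [j ?]] := (near_p v e0, near_p v' e0); exists i, j.
Qed.

Let ext_linear a v v' w w' : ext v w -> ext v' w' -> ext (a *: v + v') (a *: w + w').
Proof.
move=> vw vw' l; apply/ler_addgt0Pr => e e0.
(* Approximating [v] and [v'] within [e'] moves both sides by at most [b * e'];
   one more than [b] in the denominator avoids a division by zero. *)
pose b := 2 * m * (nrm a + 1).
have b0 : 0 <= b by rewrite !mulr_ge0// addr_ge0// nrm_ge0.
have b1 : 0 < b + 1 by rewrite ltr_wpDl.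
pose e' := e / (b + 1).
have e'0 : 0 < e' by rewrite divr_gt0.
have [i [j [hi hj]]] := near_p2 v v' e'0.
have be : b * e' <= e.
  rewrite (@le_trans _ _ ((b + 1) * e'))//; first by rewrite ler_wpM2r ?lerDl// ltW.
  by rewrite mulrCA divff ?mulr1// gt_eqF.
have diff (U : normedModType K) (x x' y y' : U) :
    nrm (a *: x + x' - (a *: y + y')) <= nrm a * nrm (x - y) + nrm (x' - y').
  by rewrite opprD addrACA -scalerBr (le_trans (nrmD _ _))// nrmZ.
have h1 := ler_nrm_sub (a *: w + w') (a *: q i + q j) (q l).
have h2 := pq a i j l.
have h3 := ler_nrm_sub (a *: p i + p j) (a *: v + v') (p l).
have h4 : nrm (a *: w + w' - (a *: q i + q j)) <= m * ((nrm a + 1) * e').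
  rewrite (le_trans (diff _ _ _ _ _))// mulrDl mul1r mulrDr lerD//.
    rewrite mulrCA ler_wpM2l ?nrm_ge0// (le_trans (vw i))// ler_wpM2l//.
    exact: ltW.
  by rewrite (le_trans (vw' j))// ler_wpM2l// ltW.
have h5 : nrm (a *: p i + p j - (a *: v + v')) <= (nrm a + 1) * e'.
  rewrite nrmB (le_trans (diff _ _ _ _ _))// mulrDl mul1r lerD//; last exact: ltW.
  by rewrite ler_wpM2l ?nrm_ge0// ltW.
have h6 : m * nrm (a *: p i + p j - p l) <=
    m * ((nrm a + 1) * e') + m * nrm (a *: v + v' - p l).
  by rewrite -mulrDr ler_wpM2l// (le_trans h3)// lerD2r.
move: h1 h2 h4 h6 be; rewrite /b -!mulrA => h1 h2 h4 h6 be.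
by apply: (le_trans h1); lra.
Qed.

Let ext_lipschitz v v' w w' : ext v w -> ext v' w' -> nrm (w - w') <= m * nrm (v - v').
Proof.
move=> vw vw'; apply/ler_addgt0Pr => e e0.
have b1 : 0 < 2 * m + 1 by rewrite ltr_wpDl ?mulr_ge0.
pose e' := e / (2 * m + 1).
have e'0 : 0 < e' by rewrite divr_gt0.
have [i hi] := near_p v e'0.
have be : 2 * m * e' <= e.
  rewrite (@le_trans _ _ ((2 * m + 1) * e'))//; first by rewrite ler_wpM2r ?lerDl// ltW.
  by rewrite mulrCA divff ?mulr1// gt_eqF.
have h1 := ler_nrm_sub w (q i) w'.
have h2 : nrm (w - q i) <= m * e' by rewrite (le_trans (vw i))// ler_wpM2l// ltW.
have h3 : nrm (q i - w') <= m * nrm (v - v') + m * e'.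
  rewrite nrmB (le_trans (vw' i))// -mulrDr ler_wpM2l//.
  by rewrite (le_trans (ler_nrm_sub _ v _))// nrmB lerD2l ltW.
by apply: (le_trans h1); move: be; rewrite -mulrA; lra.
Qed.

(** The hypothesis [pq] says that [p i |-> q i] is well defined, linear and
    [m]-bounded on what the [p i] span, without a linear structure on the
    index set. The second property of [L] identifies [L v] from distances to
    the family alone; it replaces any approximation argument when a candidate
    for [L v] is already known. *)
Lemma dense_linear_extension : exists L : {linear V -> W},
  (forall v, nrm (L v) <= m * nrm v) /\
  forall v w, (forall i, nrm (w - q i) <= m * nrm (v - p i)) -> L v = w.
Proof.
have [f fP] := choice ext_exists.
have f_uniq v w : ext v w -> f v = w.
  move=> vw; apply/eqP; rewrite -subr_eq0; apply/eqP/nrm0_eq0/eqP.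
  by rewrite eq_le nrm_ge0 andbT (le_trans (ext_lipschitz (fP v) vw))// subrr nrm0 mulr0.
have f_lin : linear f by move=> a v v'; apply: f_uniq; exact: ext_linear.
pose lin := GRing.isLinear.Build K V W *:%R f f_lin.
pose L : {linear V -> W} := HB.pack f lin.
exists L; split=> [v|v w]; last exact: f_uniq.
have := ext_lipschitz (fP v) (fP 0).
by rewrite (linear0 L : f 0 = 0) !subr0.
Qed.

End extension.

End normed_spaces.

(** * Integrals and essential bounds *)

Section measure_lemmas.
Context {R : realType} {d : measure_display} {X : measurableType d}.
Variable mu : {measure set X -> \bar R}.

Lemma ae_forall_countable (I : countType) (P : I -> X -> Prop) :
  (forall i, \forall x \ae mu, P i x) -> \forall x \ae mu, forall i, P i x.
Proof.
move=> aeP; pose Q n x := if @unpickle I n is Some i then P i x else True.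
have /ae_foralln : forall n, \forall x \ae mu, Q n x.
  by move=> n; rewrite /Q; case: unpickle => [i|]; [exact: aeP|exact: nearW].
by apply: filterS => x H i; have := H (pickle i); rewrite /Q pickleK.
Qed.

Lemma Lfun_bounded (f : X -> R) (M : R) : measurable_fun [set: X] f ->
  (\forall x \ae mu, `|f x| <= M) -> f \in Lfun mu +oo%E.
Proof.
move=> mf fM; apply/andP; split; rewrite inE//=.
rewrite /finite_norm unlock /Lnorm; case: ifPn => // _.
by apply: le_lt_trans (ltry M); apply/ess_supP.
Qed.

Lemma Lnormy_le (f : X -> \bar R) (M : \bar R) : (0 <= M)%E ->
  (\forall x \ae mu, (`|f x| <= M)%E) -> ('N[mu]_+oo[f] <= M)%E.
Proof.
by move=> M0 fM; rewrite unlock /Lnorm; case: ifPn => // _; exact/ess_supP.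
Qed.

Lemma ae_le_Lnorm_ereal (f : X -> \bar R) :
  \forall x \ae mu, (`|f x| <= 'N[mu]_+oo[f])%E.
Proof.
have [mu0|/negP mu0] := boolP (0 < mu [set: X])%E; last exact: ae_mu0.
by rewrite unlock mu0; exact: ess_sup_ge.
Qed.

(** For nonnegative reals the inverse is the power [-1], also at zero. *)
Lemma ge0_measurable_funV (f : X -> R) : measurable_fun [set: X] f ->
  (forall x, 0 <= f x) -> measurable_fun [set: X] (fun x => (f x)^-1).
Proof.
move=> mf f0; rewrite (_ : (fun _ => _) = (@powR R ^~ (-1)) \o f).
  exact: measurableT_comp (measurable_powR _) mf.
by apply/funext => x; rewrite /= powR_inv1.
Qed.

(** Take for [A] the set where [g < f]: there the nonnegative function [f - g]
    has integral at most zero. *)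
Lemma ae_le_of_integral_le (f g : X -> R) :
  mu.-integrable [set: X] (EFin \o f) -> mu.-integrable [set: X] (EFin \o g) ->
  (forall A, measurable A ->
    (\int[mu]_(x in A) (f x)%:E <= \int[mu]_(x in A) (g x)%:E)%E) ->
  \forall x \ae mu, f x <= g x.
Proof.
move=> fi gi fg.
have mf : measurable_fun [set: X] f.
  by apply/measurable_EFinP; exact: (measurable_int _ fi).
have mg : measurable_fun [set: X] g.
  by apply/measurable_EFinP; exact: (measurable_int _ gi).
pose A := [set x | g x < f x].
have mA : measurable A.
  by rewrite -[A]setTI; exact: measurable_fun_ltr.
have fAi := integrableS measurableT mA (@subsetT _ _) fi.
have gAi := integrableS measurableT mA (@subsetT _ _) gi.
have iA : (\int[mu]_(x in A) `|(f x - g x)%:E| = 0)%E.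
  apply/eqP; rewrite eq_le integral_ge0// andbT.
  rewrite (eq_integral (fun x => (f x)%:E - (g x)%:E)%E); last first.
    by move=> x /[!inE] Ax; rewrite gee0_abs// lee_fin subr_ge0 ltW.
  by rewrite integralB// sube_le0 fg.
have mfg : measurable_fun A (fun x => (f x - g x)%:E).
  by apply/measurable_funTS/measurable_EFinP/measurable_funB.
have /(_ iA) := (ae_eq_integral_abs mu mA mfg).1.
apply: filterS => x /= H; rewrite leNgt; apply/negP => /[dup] gf.
by move/H => -[] /eqP; rewrite subr_eq0 => /eqP fgx; rewrite fgx ltxx in gf.
Qed.

(** The weighted sum of the indicators of sets [F n] of finite measure covering
    the space, with weights [2^-n / (1 + mu (F n))], so that both the sum and
    its integral are dominated by a geometric series. *)
Lemma sigma_finite_positive_integrable : sigma_finite [set: X] mu ->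
  exists h : X -> R, [/\ measurable_fun [set: X] h, forall x, 0 < h x &
    (\int[mu]_x (h x)%:E < +oo)%E].
Proof.
case=> F XF mF.
have mF1 n := (mF n).1.
pose a n : R := 2^-1 ^+ n / (1 + fine (mu (F n))).
have den_gt0 n : 0 < 1 + fine (mu (F n)) by rewrite ltr_pwDl ?fine_ge0.
have a0 n : 0 < a n by rewrite divr_gt0// exprn_gt0.
have aF n : ((a n)%:E * mu (F n) <= (2^-1 ^+ n)%:E)%E.
  rewrite -(@fineK _ (mu (F n))) ?ge0_fin_numE ?(mF n).2// -EFinM lee_fin.
  by rewrite /a mulrAC ler_pdivrMr// ler_wpM2l ?exprn_ge0// lerDr.
have a1 n : a n <= 2^-1 ^+ n.
  by rewrite /a ler_pdivrMr// ler_peMr ?exprn_ge0// lerDl fine_ge0.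
pose t n x : \bar R := (a n * \1_(F n) x)%:E.
have t0 n x : (0 <= t n x)%E by rewrite lee_fin mulr_ge0// ltW.
have mt n : measurable_fun [set: X] (t n).
  by apply/measurable_EFinP; apply: measurable_funM => //; exact: measurable_indic.
have half : (\sum_(0 <= n <oo) (2^-1 ^+ n)%:E <= 2%:E :> \bar R)%E.
  apply: lime_le; first by apply: is_cvg_nneseries => n *; rewrite lee_fin exprn_ge0.
  apply: nearW => n; rewrite sumEFin lee_fin.
  have := @half_pow_sum R n; rewrite -mulr_sumr; lra.
pose h x : \bar R := (\sum_(0 <= n <oo) t n x)%E.
have h_fin x : h x \is a fin_num.
  rewrite ge0_fin_numE ?nneseries_ge0// (le_lt_trans _ (ltry 2))//.
  apply: le_trans half; apply: lee_nneseries => // n _; rewrite lee_fin.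
  by rewrite (le_trans _ (a1 n))// ler_piMr// ltW.
have mh : measurable_fun [set: X] h by apply: ge0_emeasurable_sum.
exists (fine \o h); split.
- by apply: measurableT_comp.
- move=> x; have [n _ Fnx] : (\bigcup_n F n) x by rewrite -XF.
  rewrite /= fine_gt0// ltey_eq h_fin andbT.
  apply: (@lt_le_trans _ _ (t n x)).
    by rewrite /t indicE mem_set// mulr1 lte_fin.
  apply: (@le_trans _ _ (\sum_(0 <= i < n.+1) t i x)%E); last first.
    by apply: nneseries_lim_ge => *; exact: t0.
  by rewrite big_nat_recr//= leeDr// sume_ge0.
- rewrite (eq_integral h); last by move=> x _; rewrite /= fineK.
  rewrite integral_nneseries// (le_lt_trans _ (ltry 2))//.
  apply: le_trans half; apply: lee_nneseries => [n _|n _].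
    by move=> _; exact: integral_ge0.
  rewrite /t; under eq_integral do rewrite EFinM.
  rewrite ge0_integralZl//; last 2 first.
  - by apply/measurable_EFinP; exact: measurable_indic.
  - by rewrite lee_fin ltW.
  by rewrite integral_indic// setIT.
Qed.

End measure_lemmas.

(** * Scalar-valued functions, automorphisms and L^1-normed modules *)

Section scalar_functions.
Context {R : realType} {k : scalar_kind}.
Local Notation K := (scalars R k).
Context {d : measure_display} {X : measurableType d}.
Variable mu : {measure set X -> \bar R}.

Lemma Kmeasurable_nrm (f : X -> K) : Kmeasurable f ->
  measurable_fun [set: X] (fun x => nrm (f x)).
Proof.
move=> mf; apply: (measurability (@RGenOInfty.G R)); first exact: RGenOInfty.measurableE.
move=> _ [_ [r ->] <-]; rewrite setTI.
have -> : (fun x => nrm (f x)) @^-1` `]r, +oo[%classic =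
    f @^-1` [set z | r < nrm z].
  by apply/seteqP; split=> x /=; rewrite in_itv/= andbT.
apply: mf; rewrite openE => z /= rz.
apply/nbhs_ballP; exists (of_real k (nrm z - r)).
  by rewrite /= -(of_real0 R k) of_real_lt subr_gt0.
move=> w; rewrite -ball_normE/= nrmE of_real_lt.
by have := nrm_lerB z w; lra.
Qed.

Lemma Kmeasurable_of_real (g : X -> R) : measurable_fun [set: X] g ->
  Kmeasurable (fun x => of_real k (g x)).
Proof.
move=> mg U oU.
suff oV : open (of_real k @^-1` U).
  by rewrite -[_ @^-1` _]setTI; exact: (mg measurableT _ (open_measurable oV)).
rewrite openE => r /= Ur.
have /nbhs_ballP[e/= e0 be] := open_nbhs_nbhs (conj oU Ur).
apply/nbhs_ballP; exists (to_real e).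
  by rewrite /= -(of_real_lt k) of_real0 to_realK// ltW.
move=> s; rewrite /ball/= => rs; apply: be.
rewrite -ball_normE/= nrmE -(to_realK (ltW e0)) of_real_lt.
have -> : of_real k r - of_real k s = of_real k (r - s).
  by rewrite of_realD; case: (k) => //=; rewrite rmorphN.
by rewrite nrm_of_real.
Qed.

Lemma Kmeasurable_addc (f : X -> K) (c : K) : Kmeasurable f ->
  Kmeasurable (fun x => f x + c).
Proof.
move=> mf U oU; apply: (mf (fun z => U (z + c))).
rewrite openE => z /= Uz.
have /nbhs_ballP[e/= e0 be] := open_nbhs_nbhs (conj oU Uz).
apply/nbhs_ballP; exists e => // w; rewrite -ball_normE/= => zw; apply: be.
by rewrite -ball_normE/= opprD addrACA subrr addr0.
Qed.

Lemma Kmeasurable_comp (f : X -> K) (g : X -> X) :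
  measurable_fun [set: X] g -> Kmeasurable f -> Kmeasurable (f \o g).
Proof. by move=> mg mf U oU; rewrite -[_ @^-1` _]setTI; exact: (mg measurableT _ (mf _ oU)). Qed.

Lemma Linf_bounded (f : X -> K) (M : R) : Kmeasurable f ->
  (\forall x \ae mu, nrm (f x) <= M) -> Linf mu f.
Proof.
move=> mf fM; split => //; apply: (@Lfun_bounded _ _ _ _ _ M).
  exact: Kmeasurable_nrm.
by apply: filterS fM => x; rewrite ger0_norm// nrm_ge0.
Qed.

Lemma Linf_le (f : X -> K) : Linf mu f ->
  \forall x \ae mu, nrm (f x) <= Linf_norm mu f.
Proof.
move=> [_ lf]; apply: filterS (ae_le_Lnormy lf) => x.
by rewrite ger0_norm ?nrm_ge0.
Qed.

Lemma Linf_cst (c : K) : Linf mu (fun=> c).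
Proof.
apply: (@Linf_bounded _ (nrm c)); last by apply: nearW => x.
move=> U _; have [Uc|nUc] := pselect (U c).
  by rewrite (_ : _ @^-1` _ = setT)//; apply/seteqP; split.
by rewrite (_ : _ @^-1` _ = set0)//; apply/seteqP; split.
Qed.

Lemma Linf_addc (f : X -> K) (c : K) : Linf mu f -> Linf mu (fun x => f x + c).
Proof.
move=> lf; have [mf _] := lf.
apply: (@Linf_bounded _ (Linf_norm mu f + nrm c)); first exact: Kmeasurable_addc.
by apply: filterS (Linf_le lf) => x h; rewrite (le_trans (nrmD _ _))// lerD2r.
Qed.

Definition Kindic (A : set X) : X -> K := fun x => of_real k (\1_A x).

Lemma nrm_Kindic A x : nrm (Kindic A x) = \1_A x.
Proof. by rewrite nrm_of_real ger0_norm. Qed.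

Lemma Kindic_preimage (f : X -> X) A x : Kindic (f @^-1` A) x = Kindic A (f x).
Proof. by []. Qed.

Lemma Linf_Kindic (A : set X) : measurable A -> Linf mu (Kindic A).
Proof.
move=> mA; apply: (@Linf_bounded _ 1); last first.
  by apply: nearW => x; rewrite nrm_Kindic indicE lern1 leq_b1.
by apply: Kmeasurable_of_real; exact: measurable_indic.
Qed.

End scalar_functions.

Section automorphisms.
Context {R : realType} {k : scalar_kind}.
Local Notation K := (scalars R k).
Context {d : measure_display} {X : measurableType d}.
Variable mu : {measure set X -> \bar R}.
Variable phi : automorphism mu.

Lemma ae_aut (P : X -> Prop) :
  (\forall x \ae mu, P x) -> \forall x \ae mu, P (phi x).
Proof.
move=> [N [mN N0 PN]]; exists (phi @^-1` N); split.
- by rewrite -[X in measurable X]setTI; exact: aut_measurable.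
- by rewrite aut_preserving.
- by move=> y Py; exact: PN.
Qed.

Lemma Linf_koopman (f : X -> K) : Linf mu f -> Linf mu (koopman phi f).
Proof.
move=> lf; have [mf _] := lf.
apply: (@Linf_bounded _ _ _ _ _ _ (Linf_norm mu f)).
  by apply: Kmeasurable_comp => //; exact: aut_inv_measurable.
exact: (ae_aut_inv phi (Linf_le lf)).
Qed.

Lemma ge0_integral_koopman (f : X -> \bar R) : measurable_fun [set: X] f ->
  (forall x, 0 <= f x)%E -> (\int[mu]_x koopman phi f x = \int[mu]_x f x)%E.
Proof.
move=> mf f0.
pose mx := isMeasurableFun.Build _ _ _ _ _ (aut_inv_measurable phi).
pose psi : {mfun X >-> X} := HB.pack (aut_inv phi) mx.
transitivity (\int[pushforward mu psi]_x f x)%E.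
  by rewrite ge0_integral_pushforward.
by apply: eq_measure_integral => A mA _; rewrite -[RHS](aut_inv_preserving phi mA).
Qed.

End automorphisms.

Section L1_module_theory.
Context {R : realType} {k : scalar_kind}.
Local Notation K := (scalars R k).
Context {d : measure_display} {X : measurableType d}.
Variable mu : {measure set X -> \bar R}.
Variable G : L1_module (k := k) mu.
Implicit Types s t : G.

(** The module is unitary, so that constants act through the scalars. *)
Lemma bm_act_cst (c : K) s : bm_act (fun=> c) s = c *: s.
Proof.
have := bm_actZl c s (Linf_cst mu 1).
by rewrite bm_act1 mulr1.
Qed.

Lemma lm_abs_measurable s : measurable_fun [set: X] (lm_abs s).
Proof. exact: Lfun_measurable (lm_abs_L1 s). Qed.

Lemma lm_abs_integrable s : mu.-integrable [set: X] (EFin \o lm_abs s).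
Proof. exact/Lfun1_integrable/lm_abs_L1. Qed.

Lemma integral_lm_abs s : (\int[mu]_x `|(lm_abs s x)%:E|)%E = (nrm s)%:E.
Proof. by rewrite -lm_abs_norm Lnorm1. Qed.

Lemma lm_absN s : \forall x \ae mu, lm_abs (- s) x = lm_abs s x.
Proof.
rewrite -scaleN1r -bm_act_cst.
apply: filterS (lm_absM s (Linf_cst mu (-1))) => x ->.
by rewrite nrmN nrm1 mul1r.
Qed.

Lemma lm_absB s t : \forall x \ae mu, lm_abs (s - t) x <= lm_abs s x + lm_abs t x.
Proof. by apply: filterS2 (lm_absD s (- t)) (lm_absN t) => x + <-. Qed.

Lemma lm_abs_eq0 s : (\forall x \ae mu, lm_abs s x = 0) -> s = 0.
Proof.
move=> s0; apply: nrm0_eq0; apply: EFin_inj; rewrite -integral_lm_abs.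
rewrite -[RHS](integral0 mu [set: X]); apply: ge0_ae_eq_integral => //.
  by apply: measurableT_comp => //; apply/measurable_EFinP/lm_abs_measurable.
by apply: filterS s0 => x -> _; rewrite abse0.
Qed.

(** Integrating over [A] is taking the norm after multiplication by the
    indicator function; this turns norm estimates into estimates of integrals. *)
Lemma integral_lm_abs_on (A : set X) s : measurable A ->
  (\int[mu]_(x in A) (lm_abs s x)%:E)%E = (nrm (bm_act (Kindic A) s))%:E.
Proof.
move=> mA; rewrite -integral_lm_abs.
have m1 (t : G) : measurable_fun [set: X] (EFin \o lm_abs t).
  exact/measurable_EFinP/lm_abs_measurable.
transitivity (\int[mu]_(x in A) `|(lm_abs s x)%:E|)%E.
  apply: ae_eq_integral => //.
  - exact: (measurable_funTS (m1 s)).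
  - by apply: measurableT_comp => //; exact: (measurable_funTS (m1 s)).
  by apply: filterS (lm_abs_ge0 s) => x s0 _; rewrite gee0_abs.
rewrite integral_mkcond; apply: ge0_ae_eq_integral => //.
- apply/measurable_restrict => //; rewrite ?setTI//.
  by apply: measurableT_comp => //; exact: (measurable_funTS (m1 s)).
- by apply: measurableT_comp => //; exact: m1.
- by move=> x _; apply: erestrict_ge0.
apply: filterS (lm_absM s (Linf_Kindic mu mA)) => x -> _.
rewrite nrm_Kindic patchE indicE; case: ifPn => _.
  by rewrite mul1r.
by rewrite mul0r abse0.
Qed.

End L1_module_theory.

(** * Module operators over an automorphism *)

Section koopman_operators.
Context {R : realType} {k : scalar_kind}.
Local Notation K := (scalars R k).
Local Notation Kindic := (@Kindic R k _ _).
Context {d : measure_display} {X : measurableType d}.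
Variable mu : {measure set X -> \bar R}.
Variable phi : automorphism mu.
Variables G L : L1_module (k := k) mu.
Variable T : {linear G -> L}.

Lemma preimage_aut_measurable A : measurable A -> measurable (phi @^-1` A).
Proof. by move=> mA; rewrite -[X in measurable X]setTI; exact: aut_measurable. Qed.

Lemma koopman_Kindic (A : set X) : \forall y \ae mu,
  koopman phi (Kindic (phi @^-1` A)) y = Kindic A y.
Proof.
by apply: filterS (aut_invK phi) => y yK; rewrite /koopman /= Kindic_preimage yK.
Qed.

Lemma koopman_abs_L1 (s : G) : koopman phi (lm_abs s) \in Lfun mu 1.
Proof. by apply: Lfun_koopman => //; exact: lm_abs_L1. Qed.

(** The counterpart of [integral_lm_abs_on] after transport along [phi]. *)
Lemma integral_koopman_abs_on (A : set X) (s : G) : measurable A ->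
  (\int[mu]_(y in A) (koopman phi (lm_abs s) y)%:E)%E =
  (nrm (bm_act (Kindic (phi @^-1` A)) s))%:E.
Proof.
move=> mA; have mA' := preimage_aut_measurable mA.
have mk : measurable_fun [set: X] (EFin \o koopman phi (lm_abs s)).
  by apply/measurable_EFinP; exact: Lfun_measurable (koopman_abs_L1 s).
have mabs : measurable_fun [set: X]
    (fun x => `|(lm_abs (bm_act (Kindic (phi @^-1` A)) s) x)%:E|%E).
  by apply: measurableT_comp => //; apply/measurable_EFinP/lm_abs_measurable.
rewrite -integral_lm_abs -(ge0_integral_koopman phi)// /koopman.
transitivity (\int[mu]_(y in A) `|(koopman phi (lm_abs s) y)%:E|)%E.
  apply: ae_eq_integral => //.
  - exact: (measurable_funTS mk).
  - by apply: measurableT_comp => //; exact: (measurable_funTS mk).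
  by apply: filterS (ae_aut_inv phi (lm_abs_ge0 s)) => y s0 _; rewrite gee0_abs.
rewrite integral_mkcond; apply: ge0_ae_eq_integral => //.
- apply/measurable_restrict => //; rewrite ?setTI//.
  by apply: measurableT_comp => //; exact: (measurable_funTS mk).
- exact: measurableT_comp mabs (aut_inv_measurable phi).
- by move=> y _; apply: erestrict_ge0.
- by move=> y _ /=.
apply: filterS2 (ae_aut_inv phi (lm_absM s (Linf_Kindic mu mA'))) (aut_invK phi).
move=> y /= -> yK _; rewrite Kindic_preimage yK nrm_Kindic patchE indicE.
case: ifPn => _.
  by rewrite mul1r.
by rewrite mul0r normr0.
Qed.

Section intertwining.
Hypothesis Tphi : koopman_linear phi T.

Lemma integral_abs_on (A : set X) (s : G) : measurable A ->
  (\int[mu]_(y in A) (lm_abs (T s) y)%:E)%E =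
  (nrm (T (bm_act (Kindic (phi @^-1` A)) s)))%:E.
Proof.
move=> mA; have mA' := preimage_aut_measurable mA.
rewrite integral_lm_abs_on// Tphi; last exact: Linf_Kindic.
congr (nrm _)%:E; apply: bm_act_ae; [exact: Linf_Kindic| |].
  by apply: Linf_koopman; exact: Linf_Kindic.
by apply: filterS (koopman_Kindic A) => y ->.
Qed.

(** Compare the integrals over each measurable [A] by applying the norm bound to
    the restriction of [s] to the preimage of [A]. *)
Lemma koopman_linear_le (C : R) : 0 <= C -> (forall s, nrm (T s) <= C * nrm s) ->
  forall s, \forall y \ae mu, lm_abs (T s) y <= C * koopman phi (lm_abs s) y.
Proof.
move=> C0 TC s; apply: ae_le_of_integral_le.
- exact: lm_abs_integrable.
- by apply/Lfun1_integrable/Lfun_scaler => //; exact: koopman_abs_L1.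
move=> A mA; rewrite integral_abs_on//.
under eq_integral do rewrite EFinM.
rewrite integralZl//; last first.
  by apply: (integrableS measurableT) => //; apply/Lfun1_integrable/koopman_abs_L1.
by rewrite integral_koopman_abs_on// -EFinM lee_fin.
Qed.

Lemma koopman_linear_ge : (forall s, nrm s <= nrm (T s)) ->
  forall s, \forall y \ae mu, koopman phi (lm_abs s) y <= lm_abs (T s) y.
Proof.
move=> TC s; apply: ae_le_of_integral_le.
- exact/Lfun1_integrable/koopman_abs_L1.
- exact: lm_abs_integrable.
by move=> A mA; rewrite integral_abs_on// integral_koopman_abs_on// lee_fin.
Qed.

End intertwining.

Lemma koopman_linear_opnorm_dominated : continuous T ->
  koopman_linear phi T -> koopman_opnorm_dominated phi T.
Proof.
move=> Tc Tphi s; have C0 : 0 <= fine (opnorm T) by rewrite fine_ge0 ?opnorm_ge0.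
apply: filterS (koopman_linear_le Tphi C0 (fun s => opnorm_bound s Tc) s) => y.
by rewrite -{2}(fineK (opnorm_fin_num Tc)) -EFinM lee_fin.
Qed.

Lemma koopman_opnorm_dominated_dominated : continuous T ->
  koopman_opnorm_dominated phi T -> koopman_dominated phi T.
Proof.
move=> Tc TC; have C0 : 0 <= fine (opnorm T) by rewrite fine_ge0 ?opnorm_ge0.
exists (fine (opnorm T) + 1); first by rewrite ltr_wpDl.
move=> s; apply: filterS2 (TC s) (ae_aut_inv phi (lm_abs_ge0 s)) => y + s0.
rewrite -{1}(fineK (opnorm_fin_num Tc)) -EFinM lee_fin => /le_trans; apply.
by rewrite ler_wpM2r// lerDl.
Qed.

(** The defect [D] of linearity at [f] is also the defect at [f - c] for every
    constant [c], hence is bounded by a multiple of [|T_phi f - c|]; at almost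
    every point this holds for a dense set of [c] simultaneously. *)
Lemma koopman_dominated_linear : koopman_dominated phi T -> koopman_linear phi T.
Proof.
case=> m m0 Tm f s lf; have lkf := Linf_koopman phi lf.
set D := T (bm_act f s) - bm_act (koopman phi f) (T s).
have Dc (c : K) : \forall y \ae mu,
    lm_abs D y <= 2 * m * nrm (koopman phi f y - c) * koopman phi (lm_abs s) y.
  have lfc := Linf_addc (- c) lf.
  have lkfc := Linf_addc (- c) lkf.
  (* Subtracting [c] from [f] subtracts [c *: T s] from both terms of [D]. *)
  have -> : D = T (bm_act (fun x => f x - c) s) -
      bm_act (fun y => koopman phi f y - c) (T s).
    rewrite !(bm_actDl _ _ (Linf_cst mu (- c)))// !bm_act_cst linearD linearZ/=.
    by rewrite opprD addrACA subrr addr0.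
  near=> y.
  have h1 : lm_abs (T (bm_act (fun x => f x - c) s)) y <=
      m * koopman phi (lm_abs (bm_act (fun x => f x - c) s)) y by near: y; exact: Tm.
  have h2 : lm_abs (T s) y <= m * koopman phi (lm_abs s) y by near: y; exact: Tm.
  have h3 : koopman phi (lm_abs (bm_act (fun x => f x - c) s)) y =
      nrm (koopman phi f y - c) * koopman phi (lm_abs s) y.
    by near: y; apply: (ae_aut_inv phi (lm_absM s lfc)).
  have h4 : lm_abs (bm_act (fun y => koopman phi f y - c) (T s)) y =
      nrm (koopman phi f y - c) * lm_abs (T s) y by near: y; exact: lm_absM.
  apply: (@le_trans _ _ (lm_abs (T (bm_act (fun x => f x - c) s)) y +
     lm_abs (bm_act (fun y => koopman phi f y - c) (T s)) y)).
    by near: y; exact: lm_absB.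
  rewrite h4; rewrite h3 in h1.
  have := ler_wpM2l (nrm_ge0 (koopman phi f y - c)) h2.
  by lra.
have Dq : \forall y \ae mu, forall q, lm_abs D y <=
    2 * m * nrm (koopman phi f y - rational_scalar q) * koopman phi (lm_abs s) y.
  by apply: ae_forall_countable => q; exact: Dc.
apply/eqP; rewrite -subr_eq0; apply/eqP/lm_abs_eq0; rewrite -/D.
apply: filterS3 Dq (lm_abs_ge0 D) (ae_aut_inv phi (lm_abs_ge0 s)) => y H D0 s0.
apply/eqP; rewrite eq_le D0 andbT; apply/ler_addgt0Pr => e e0; rewrite add0r.
pose b := 2 * m * koopman phi (lm_abs s) y.
have b0 : 0 <= b by rewrite !mulr_ge0// ltW.
have b1 : 0 < b + 1 by rewrite ltr_wpDl.
have [q qP] := rational_scalar_dense (koopman phi f y) (divr_gt0 e0 b1).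
apply: (le_trans (H q)); rewrite mulrAC -/b.
apply: (@le_trans _ _ ((b + 1) * (e / (b + 1)))).
  by apply: ler_pM => //; rewrite ?nrm_ge0 ?lerDl// ltW.
by rewrite mulrCA divff ?mulr1// gt_eqF.
Unshelve. all: by end_near. Qed.

End koopman_operators.

(** * Dense sequences of integrable sections *)

Section rational_combinations.
Context {R : realType} {k : scalar_kind}.
Local Notation K := (scalars R k).

Definition rational_combination (V : lmodType K) (v_ : nat -> V)
    (c : seq (rat * rat)) : V :=
  \sum_(i < size c) rational_scalar (nth (0, 0) c i) *: v_ i.

Lemma nrm_sum (V : normedZmodType K) n (v_ : nat -> V) :
  nrm (\sum_(i < n) v_ i) <= \sum_(i < n) nrm (v_ i).
Proof.
elim: n => [|n IH]; first by rewrite !big_ord0 nrm0.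
by rewrite !big_ord_recr/= (le_trans (nrmD _ _))// lerD2r.
Qed.

(** Approximating each coefficient suffices, with a tolerance that depends on the
    norm of the vector that it multiplies and on the number of summands. *)
Lemma dense_rational_combination (V : normedModType K) (v_ : nat -> V) :
  dense (lin_span v_) -> dense (range (rational_combination v_)).
Proof.
move=> /dense_nrm vd; apply/dense_nrm => v e e0.
have e2 : 0 < e / 2 by rewrite divr_gt0.
have [_ [n [a ->]] va] := vd v _ e2.
have qe i : exists q, nrm (a i - rational_scalar q) * nrm (v_ i) <= e / 2 / n.+1%:R.
  have b1 : 0 < nrm (v_ i) + 1 by rewrite ltr_wpDl ?nrm_ge0.
  have en : 0 < e / 2 / n.+1%:R by rewrite divr_gt0.
  have [q qP] := rational_scalar_dense (a i) (divr_gt0 en b1); exists q.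
  rewrite (@le_trans _ _ (e / 2 / n.+1%:R / (nrm (v_ i) + 1) * (nrm (v_ i) + 1)))//.
    by rewrite ler_pM ?nrm_ge0 ?lerDl// ltW.
  by rewrite divfK// gt_eqF.
have [q qP] := choice qe.
exists (rational_combination v_ (mkseq q n)); first by exists (mkseq q n).
rewrite (le_lt_trans (ler_nrm_sub _ (\sum_(i < n) a i *: v_ i) _))//.
suff : nrm (\sum_(i < n) a i *: v_ i - rational_combination v_ (mkseq q n)) <= e / 2.
  by move: va; lra.
have -> : rational_combination v_ (mkseq q n) =
    \sum_(i < n) rational_scalar (q i) *: v_ i.
  rewrite /rational_combination size_mkseq; apply: eq_bigr => i _.
  by rewrite nth_mkseq.
rewrite -sumrB; under eq_bigr do rewrite -scalerBl.
rewrite (le_trans (@nrm_sum _ n (fun i => (a i - rational_scalar (q i)) *: v_ i)))//.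
rewrite (@le_trans _ _ (\sum_(i < n) e / 2 / n.+1%:R))//.
  by apply: ler_sum => i _; rewrite nrmZ.
rewrite sumr_const card_ord -[leLHS]mulr_natr -(mulrA (e / 2)) ler_piMr ?(ltW e2)//.
by rewrite mulrC ler_pdivrMr// mul1r ler_nat.
Qed.

Lemma dense_lin_span_scale (V : normedModType K) (v_ : nat -> V) (r : nat -> R) :
  (forall i, 0 < r i) -> dense (lin_span v_) ->
  dense (lin_span (fun i => of_real k (r i) *: v_ i)).
Proof.
move=> r0 vd O O0 oO; have [v [Ov [n [a va]]]] := vd O O0 oO.
exists v; split=> //; exists n, (fun i => a i * of_real k (r i)^-1).
rewrite va; apply: eq_bigr => i _.
by rewrite scalerA -mulrA -of_realM mulVf ?of_real1 ?mulr1// gt_eqF.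
Qed.

End rational_combinations.

Section integrable_sections.
Context {R : realType} {k : scalar_kind}.
Local Notation K := (scalars R k).
Context {d : measure_display} {X : measurableType d}.
Variable mu : {measure set X -> \bar R}.
Hypothesis mu_sigma_finite : sigma_finite [set: X] mu.
Variable E : bundle (k := k) mu.

(** With [h] positive and integrable, [h / (1 + |s|)] works. The factor is
    strictly positive, so that the rescaling loses no information: it preserves
    fiberwise spans, and statements on all measurable sections can be deduced
    from integrable ones. *)
Lemma integrable_rescaling (s : sections E) : msec s ->
  exists r : X -> R, [/\ measurable_fun [set: X] r, forall x, 0 < r x &
    ((fun x => of_real k (r x) *: s x) : sections E) \in psec (@lexx _ _ 1%E)].
Proof.
move=> ms; have [h [mh h0 hi]] := sigma_finite_positive_integrable mu_sigma_finite.
have s1 x : 0 < 1 + nrm (s x) by rewrite ltr_pwDl// nrm_ge0.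
have r0 x : 0 < h x / (1 + nrm (s x)) by rewrite divr_gt0.
have mr : measurable_fun [set: X] (fun x => h x / (1 + nrm (s x))).
  apply: measurable_funM => //; apply: ge0_measurable_funV => [|x]; last exact: ltW.
  by apply: measurable_funD => //; exact: msec_norm.
exists (fun x => h x / (1 + nrm (s x))); split => //.
have mrs := msecM (Kmeasurable_of_real (k := k) mr) ms.
apply/psecP; split => //.
apply: (@le_Lfun _ _ _ mu _ _ h) => //.
- exact: (msec_norm mrs).
- apply: nearW => x; rewrite ger0_norm ?nrm_ge0// (ger0_norm (ltW (h0 x))).
  rewrite /snrm nrmZ nrm_of_real (ger0_norm (ltW (r0 x))).
  by rewrite mulrAC ler_pdivrMr// ler_wpM2l ?(ltW (h0 x))// lerDr.
- apply/Lfun1_integrable/integrableP; split; first exact/measurable_EFinP.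
  by under eq_integral => x _ do rewrite /= ger0_norm ?(ltW (h0 x))//.
Qed.

Lemma sections_combinationE (S : nat -> sections E) c x :
  rational_combination S c x = rational_combination (S ^~ x) c.
Proof.
rewrite /rational_combination; elim: (size c) => [|n IH]; first by rewrite !big_ord0.
by rewrite !big_ord_recr/= -IH.
Qed.

(** Passing from dense spans to a dense sequence makes it possible to treat all
    linear combinations on a single set of full measure. *)
Lemma separable_dense_sequence : separable_bundle E ->
  exists U : nat -> Gamma1 E,
    \forall x \ae mu, dense (range (fun n => vsec (U n) x)).
Proof.
case=> s [ms sd].
have [r rP] := choice (fun n => integrable_rescaling (ms n)).
pose S n : sections E := fun x => of_real k (r n x) *: s n x.
have SP c : rational_combination S c \in psec (@lexx _ _ 1%E).
  by apply: rpred_sum => i _; apply: rpredZ; have [] := rP i.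
pose U n : Gamma1 E := if unpickle n is Some c
  then cls (@lexx _ _ 1%E) (rational_combination S c) else 0.
exists U.
have UE : \forall x \ae mu, forall c : seq (rat * rat),
    vsec (U (pickle c)) x = rational_combination (S ^~ x) c.
  apply: ae_forall_countable => c; rewrite /U pickleK.
  by apply: filterS (vsec_cls (SP c)) => x ->; rewrite sections_combinationE.
apply: filterS2 sd UE => x sdx UEx.
have r0 i : 0 < r i x by have [_ + _] := rP i; apply.
have := dense_rational_combination (dense_lin_span_scale r0 sdx).
move=> D O O0 oO; have [v [Ov [c _ cv]]] := D O O0 oO.
by exists v; split => //; exists (pickle c); rewrite // UEx.
Qed.

End integrable_sections.

(** * Testing linear maps on a dense family; premorphisms fiber by fiber *)

Section dense_families.
Context {R : realType} {k : scalar_kind}.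
Local Notation K := (scalars R k).
Variables (V W : normedModType K) (I : Type) (p : I -> V).
Hypothesis p_dense : dense (range p).

(** The two one-sided Lipschitz conditions cover norms, multiples of norms and
    norms of images, which is how the lemmas below specialize it. *)
Lemma lipschitz_le_dense (f g : V -> R) (C : R) :
  (forall v w, f v <= f w + C * nrm (v - w)) ->
  (forall v w, g v <= g w + C * nrm (v - w)) ->
  (forall i, f (p i) <= g (p i)) -> forall v, f v <= g v.
Proof.
move=> fC gC fg v; apply/ler_addgt0Pr => e e0.
have C1 : 0 < `|C| + 1 by rewrite ltr_wpDl.
have e2 : 0 < e / 2 by rewrite divr_gt0.
have /dense_nrm/(_ v _ (divr_gt0 e2 C1))[_ [i _ <-]] := p_dense.
rewrite ltr_pdivlMr// mulrC => vi.
have Ce : C * nrm (v - p i) <= e / 2.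
  rewrite (le_trans _ (ltW vi))// ler_wpM2r ?nrm_ge0//.
  by rewrite (le_trans (ler_norm _))// lerDl.
have := fC v (p i); have := gC (p i) v; have := fg i.
by rewrite (nrmB (p i)); move: Ce; lra.
Qed.

Lemma nrm_lipschitz (L : {linear V -> W}) : continuous L -> forall v w,
  nrm (L v) <= nrm (L w) + fine (opnorm L) * nrm (v - w).
Proof.
move=> Lc v w; rewrite (le_trans (nrm_lerB _ (L w)))// lerD2l -linearB.
exact: opnorm_bound.
Qed.

Lemma linear_le_dense (L : {linear V -> W}) (c : R) : 0 <= c -> continuous L ->
  (forall i, nrm (L (p i)) <= c * nrm (p i)) -> forall v, nrm (L v) <= c * nrm v.
Proof.
move=> c0 Lc; have M0 : 0 <= fine (opnorm L) by rewrite fine_ge0 ?opnorm_ge0.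
apply: (@lipschitz_le_dense _ _ (fine (opnorm L) + c)) => v w.
  rewrite (le_trans (nrm_lipschitz Lc v w))// lerD2l ler_wpM2r ?nrm_ge0//.
  by rewrite lerDl.
rewrite (@le_trans _ _ (c * nrm w + c * nrm (v - w)))//.
  by rewrite -mulrDr ler_wpM2l// nrm_lerB.
by rewrite lerD2l ler_wpM2r ?nrm_ge0// lerDr.
Qed.

Lemma linear_ge_dense (L : {linear V -> W}) : continuous L ->
  (forall i, nrm (p i) <= nrm (L (p i))) -> forall v, nrm v <= nrm (L v).
Proof.
move=> Lc; have M0 : 0 <= fine (opnorm L) by rewrite fine_ge0 ?opnorm_ge0.
apply: (@lipschitz_le_dense _ _ (fine (opnorm L) + 1)) => v w.
  rewrite (le_trans (nrm_lerB _ w))// lerD2l ler_peMl ?nrm_ge0//.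
  by rewrite lerDr.
rewrite (le_trans (nrm_lipschitz Lc v w))// lerD2l ler_wpM2r ?nrm_ge0//.
by rewrite lerDl.
Qed.

Lemma linear_eq_dense (L L' : {linear V -> W}) : continuous L -> continuous L' ->
  (forall i, L (p i) = L' (p i)) -> L =1 L'.
Proof.
move=> Lc Lc' LL' v; apply/eqP; rewrite -subr_eq0; apply/eqP/nrm0_eq0/eqP.
rewrite eq_le nrm_ge0 andbT; move: v.
apply: (@lipschitz_le_dense _ (fun=> 0) (fine (opnorm L) + fine (opnorm L'))).
- move=> v w; rewrite (le_trans (nrm_lerB _ (L w - L' w)))// lerD2l.
  have -> : L v - L' v - (L w - L' w) = L (v - w) - L' (v - w).
    by rewrite (linearB L) (linearB L') !opprD !opprK addrACA.
  by rewrite (le_trans (nrmD _ _))// nrmN mulrDl lerD// opnorm_bound.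
- by move=> v w; rewrite add0r mulr_ge0 ?nrm_ge0// addr_ge0 ?fine_ge0 ?opnorm_ge0.
- by move=> i; rewrite LL' subrr nrm0.
Qed.

(** Countably many ratios compute the operator norm; a ratio with [p i = 0] is
    zero by the convention on division, as it should be since [L] vanishes there. *)
Lemma opnorm_dense (L : {linear V -> W}) : continuous L ->
  opnorm L = ereal_sup [set (nrm (L (p i)) / nrm (p i))%:E | i in [set: I]].
Proof.
move=> Lc; set s := ereal_sup _; apply/eqP; rewrite eq_le; apply/andP; split; last first.
  apply: ge_ereal_sup => _ [i _ <-]; rewrite -(fineK (opnorm_fin_num Lc)) lee_fin.
  have [->|pi0] := eqVneq (nrm (p i)) 0.
    by rewrite invr0 mulr0 fine_ge0 ?opnorm_ge0.
  by rewrite ler_pdivrMr ?opnorm_bound// lt_neqAle eq_sym pi0 nrm_ge0.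
have si i : ((nrm (L (p i)) / nrm (p i))%:E <= s)%E.
  by apply: ereal_sup_ubound; exists i.
have [i0 _] : exists i : I, True.
  by have /dense_nrm/(_ 0 1 ltr01)[_ [i _ _] _] := p_dense; exists i.
have s0 : (0 <= s)%E.
  by apply: le_trans (si i0); rewrite lee_fin divr_ge0 ?nrm_ge0.
have [sy|] := boolP (s < +oo)%E; last by rewrite ltey negbK => /eqP ->; rewrite leey.
have sfin : s \is a fin_num by rewrite ge0_fin_numE.
rewrite -(fineK sfin); apply: opnorm_le; first exact: fine_ge0.
apply: linear_le_dense => //; first exact: fine_ge0.
move=> i; have [pi0|pi0] := eqVneq (nrm (p i)) 0.
  by rewrite pi0 mulr0 (nrm0_eq0 pi0) linear0 nrm0.
rewrite -ler_pdivrMr; first by rewrite -lee_fin fineK.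
by rewrite lt_neqAle eq_sym pi0 nrm_ge0.
Qed.

End dense_families.

Section premorphisms.
Context {R : realType} {k : scalar_kind}.
Local Notation K := (scalars R k).
Context {d : measure_display} {X : measurableType d}.
Variable mu : {measure set X -> \bar R}.
Variable phi : automorphism mu.
Variables E F : bundle (k := k) mu.
Implicit Type Phi : Defs.total E -> Defs.total F.

(** [L] describes [Phi] on the fiber over [x]. Being a condition on a plain
    function, it can be used without choosing the linear structure of [L]. *)
Definition fiberwise Phi (x : X) (L : fiber E x -> fiber F (phi x)) : Prop :=
  forall v, Phi (existT _ x v) = existT _ (phi x) (L v).

(** The values of the induced operator are computed at points [phi x], as images
    under the fiber map over [x]; this carries them to a generic point. *)
Lemma ae_of_ae_aut (P : X -> Prop) :
  (\forall x \ae mu, P (phi x)) -> \forall y \ae mu, P y.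
Proof. by move=> /(ae_aut_inv phi); apply: filterS2 (aut_invK phi) => y /= ->. Qed.

Lemma fiberwise_norm Phi x (L : fiber E x -> fiber F (phi x)) :
  fiberwise Phi L -> fiber_norm Phi x = opnorm L.
Proof.
move=> PhiL; rewrite /fiber_norm /opnorm; congr ereal_sup.
by apply/seteqP; split => _ [v v1 <-]; exists v => //; rewrite PhiL.
Qed.

Lemma premorphism_fiberwise Phi : premorphism phi Phi ->
  \forall x \ae mu, exists L : {linear fiber E x -> fiber F (phi x)},
    continuous L /\ fiberwise Phi L.
Proof. by case. Qed.

Lemma premorphism_apply Phi p (p1 : (1 <= p)%E) (u : Gamma p1 E) :
  premorphism phi Phi ->
  \forall x \ae mu, forall L, @fiberwise Phi x L ->
    vsec (morph_op phi Phi u) (phi x) = L (vsec u x).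
Proof.
move=> PhiP; apply: filterS2 (autK phi) (ae_aut phi (morph_opP PhiP u)) => x xK.
rewrite xK => e L PhiL; rewrite PhiL in e.
exact: eq_from_Tagged e.
Qed.

Lemma premorphism_apply_seq Phi p (p1 : (1 <= p)%E) (U : nat -> Gamma p1 E) :
  premorphism phi Phi ->
  \forall x \ae mu, exists L : {linear fiber E x -> fiber F (phi x)},
    [/\ continuous L, fiberwise Phi L &
      forall n, vsec (morph_op phi Phi (U n)) (phi x) = L (vsec (U n) x)].
Proof.
move=> PhiP; have H n := premorphism_apply (U n) PhiP.
apply: filterS2 (premorphism_fiberwise PhiP) (ae_foralln H) => x [L [Lc PhiL]] Hx.
by exists L; split => // n; exact: Hx.
Qed.

Lemma ae_le_Gammay_norm (u : Gammay E) : \forall x \ae mu, snrm (vsec u) x <= nrm u.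
Proof.
rewrite nrm_Gamma; apply: filterS (ae_le_Lnormy (vsec_Lfun u)) => x.
by rewrite ger0_norm// /snrm nrm_ge0.
Qed.

Lemma Gammay_norm_le (u : Gammay E) (M : R) : 0 <= M ->
  (\forall x \ae mu, snrm (vsec u) x <= M) -> nrm u <= M.
Proof.
move=> M0 uM; rewrite nrm_Gamma -lee_fin Gamma_normE; apply: Lnormy_le => //.
by apply: filterS uM => x uxM; rewrite /= ger0_norm ?nrm_ge0.
Qed.

(** The value is zero where [s] vanishes, since zero is its own inverse. *)
Definition normalized_section (s : sections E) : sections E :=
  fun x => of_real k (nrm (s x))^-1 *: s x.

Lemma nrm_normalized_section s x : nrm (normalized_section s x) <= 1.
Proof.
rewrite nrmZ nrm_of_real ger0_norm ?invr_ge0 ?nrm_ge0//.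
by have [->|s0] := eqVneq (nrm (s x)) 0; rewrite ?mulr0// mulVf.
Qed.

Lemma normalized_section_psec s : msec s ->
  normalized_section s \in psec (@leey _ 1%E).
Proof.
move=> ms; have mn : msec (normalized_section s).
  apply: msecM => //; apply: Kmeasurable_of_real; apply: ge0_measurable_funV.
    exact: msec_norm.
  by move=> x; exact: nrm_ge0.
apply/psecP; split=> //; apply: (@Lfun_bounded _ _ _ _ _ 1).
  exact: (msec_norm mn).
by apply: nearW => x; rewrite ger0_norm ?nrm_ge0// nrm_normalized_section.
Qed.

Definition normalization (s : sections E) : Gammay E :=
  cls (@leey _ 1%E) (normalized_section s).

Lemma vsec_normalization s : msec s ->
  \forall x \ae mu, vsec (normalization s) x = normalized_section s x.
Proof. by move=> /normalized_section_psec /vsec_cls. Qed.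

Lemma snrm_normalization_le1 s : msec s ->
  \forall x \ae mu, snrm (vsec (normalization s)) x <= 1.
Proof.
move=> /vsec_normalization; apply: filterS => x; rewrite /snrm => ->.
exact: nrm_normalized_section.
Qed.

End premorphisms.

(** * The operator induced by a morphism *)

Section morphism_norms.
Context {R : realType} {k : scalar_kind}.
Local Notation K := (scalars R k).
Context {d : measure_display} {X : measurableType d}.
Variable mu : {measure set X -> \bar R}.
Variable phi : automorphism mu.
Variables E F : bundle (k := k) mu.
Variable U : nat -> Gamma1 E.
Hypothesis U_dense : \forall x \ae mu, dense (range (fun n => vsec (U n) x)).
Variable Phi : Defs.total E -> Defs.total F.
Hypothesis PhiP : premorphism phi Phi.

Lemma morph_op_koopman_linear (T : {linear Gamma1_module E -> Gamma1_module F}) :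
  T =1 morph_op1 phi Phi -> koopman_linear phi T.
Proof.
move=> TE f s lf; rewrite !TE; apply: vsec_inj; apply: (@ae_of_ae_aut _ _ _ _ phi).
have act_apply : \forall x \ae mu, forall L, @fiberwise _ _ _ _ _ phi E F Phi x L ->
    vsec (morph_op1 phi Phi (Gamma1_act f s)) (phi x) = L (f x *: vsec s x).
  apply: filterS2 (vsec_act s lf) (premorphism_apply (Gamma1_act f s) PhiP).
  by move=> x e H L PhiL; rewrite /morph_op1 (H L PhiL) e.
have fiber_lin : \forall x \ae mu,
    vsec (morph_op1 phi Phi (Gamma1_act f s)) (phi x) =
    f x *: vsec (morph_op1 phi Phi s) (phi x).
  apply: filterS3 (premorphism_fiberwise PhiP) (premorphism_apply (s : Gamma1 E) PhiP)
    act_apply.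
  move=> x [L [_ PhiL]] /(_ L PhiL) es /(_ L PhiL) efs.
  by rewrite efs /morph_op1 es linearZ.
apply: filterS3 fiber_lin (autK phi)
  (ae_aut phi (vsec_act (morph_op1 phi Phi s) (Linf_koopman phi lf))).
by move=> x e1 xK e2; rewrite [LHS]e1 [RHS]e2 /koopman /= xK.
Qed.

(** The fiber maps of both morphisms agree on the dense values of the [U n]. *)
Lemma morph_op_inj Phi' : premorphism phi Phi' ->
  (forall n, morph_op1 phi Phi (U n) = morph_op1 phi Phi' (U n)) ->
  morph_eq Phi Phi'.
Proof.
move=> PhiP' UE.
apply: filterS3 U_dense (premorphism_apply_seq U PhiP) (premorphism_apply_seq U PhiP').
move=> x Ux [L [Lc PhiL LU]] [L' [Lc' PhiL' LU']] v.
rewrite PhiL PhiL'; congr existT; apply: (linear_eq_dense Ux) => // n.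
by rewrite -LU -LU' -[RHS]/(vsec (morph_op1 phi Phi' (U n)) (phi x)) -UE.
Qed.

(** The supremum on the right involves only measurable functions; together with
    completeness of the measure this yields measurability of [|Phi|]. *)
Lemma fiber_norm_sup : \forall x \ae mu, fiber_norm Phi x =
  ereal_sup [set (nrm (vsec (morph_op1 phi Phi (U n)) (phi x)) /
                  nrm (vsec (U n) x))%:E | n in [set: nat]].
Proof.
apply: filterS2 U_dense (premorphism_apply_seq U PhiP) => x Ux [L [Lc PhiL LU]].
rewrite (fiberwise_norm PhiL) (opnorm_dense Ux Lc); congr ereal_sup.
by apply/seteqP; split => _ [n _ <-]; exists n => //; rewrite -LU.
Qed.

Lemma morph_abs_measurable : measure_is_complete mu ->
  measurable_fun [set: X] (morph_abs Phi).
Proof.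
move=> cmu; apply/measurableT_comp => //.
apply: (ae_measurable_fun cmu (f := fun x => ereal_sup
  [set (nrm (vsec (morph_op1 phi Phi (U n)) (phi x)) /
        nrm (vsec (U n) x))%:E | n in [set: nat]])).
  by apply: filterS fiber_norm_sup => x ->.
pose h n x := (nrm (vsec (morph_op1 phi Phi (U n)) (phi x)) / nrm (vsec (U n) x))%:E.
rewrite (_ : (fun _ => _) = (fun x => esups (h ^~ x) 0%N)); last first.
  apply/funext => x; rewrite /esups; congr ereal_sup.
  by apply/seteqP; split => _ [n _ <-]; exists n.
apply: measurable_fun_esups => n; apply/measurable_EFinP/measurable_funM.
  exact: measurableT_comp (vsec_mfun _) (aut_measurable phi).
by apply: ge0_measurable_funV => [|x]; [exact: vsec_mfun|exact: nrm_ge0].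
Qed.

Lemma fiber_norm_ge0 x : (0 <= fiber_norm Phi x)%E.
Proof.
pose v : fiber E x := 0.
apply: (@le_trans _ _ (tnrm (Phi (existT _ x v)))%:E); first by rewrite lee_fin nrm_ge0.
by apply: ereal_sup_ubound; exists v => //=; rewrite nrm0.
Qed.

Lemma fiber_norm_fin_num : \forall x \ae mu, fiber_norm Phi x \is a fin_num.
Proof.
apply: filterS (premorphism_fiberwise PhiP) => x [L [Lc PhiL]].
by rewrite (fiberwise_norm PhiL) opnorm_fin_num.
Qed.

Lemma morph_norm_fin_num : morph_norm Phi \is a fin_num.
Proof. by case: PhiP => _ _ _ Phiy; rewrite ge0_fin_numE ?Lnorm_ge0. Qed.

Lemma morph_abs_Lfun : measure_is_complete mu -> morph_abs Phi \in Lfun mu +oo%E.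
Proof.
move=> cmu; apply: (@Lfun_bounded _ _ _ _ _ (fine (morph_norm Phi))).
  exact: morph_abs_measurable.
apply: filterS2 fiber_norm_fin_num (ae_le_Lnorm_ereal mu (fiber_norm Phi)) => x fx.
by rewrite -lee_fin (fineK morph_norm_fin_num) -abse_EFin /morph_abs fineK.
Qed.

Lemma morph_op_norm_le p (p1 : (1 <= p)%E) (u : Gamma p1 E) : \forall x \ae mu,
  snrm (vsec (morph_op phi Phi u)) (phi x) <= fine (morph_norm Phi) * snrm (vsec u) x.
Proof.
apply: filterS3 (premorphism_fiberwise PhiP) (premorphism_apply u PhiP)
  (premorphism_le PhiP) => x [L [_ PhiL]] /(_ L PhiL) e /(_ (vsec u x)).
by rewrite PhiL /snrm e.
Qed.

Lemma morph_op_abs_le p (p1 : (1 <= p)%E) (u : Gamma p1 E) : \forall x \ae mu,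
  snrm (vsec (morph_op phi Phi u)) (phi x) <= morph_abs Phi x * snrm (vsec u) x.
Proof.
apply: filterS2 (premorphism_fiberwise PhiP) (premorphism_apply u PhiP).
move=> x [L [Lc PhiL]] /(_ L PhiL) e.
by rewrite /snrm e /morph_abs (fiberwise_norm PhiL) opnorm_bound.
Qed.

(** The normalized sections realize the ratios of [fiber_norm_sup] within the unit
    ball of the L^oo sections, for all [n] on one set of full measure. *)
Lemma snrm_morph_op_normalization : \forall x \ae mu, forall n,
  snrm (vsec (morph_opy phi Phi (normalization (vsec (U n))))) (phi x) =
  nrm (vsec (morph_op1 phi Phi (U n)) (phi x)) / nrm (vsec (U n) x).
Proof.
have nE := ae_foralln (fun n => vsec_normalization (vsec_meas (U n))).
have nU := premorphism_apply_seq (fun n => normalization (vsec (U n))) PhiP.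
have PU := ae_foralln (fun n => premorphism_apply (U n) PhiP).
apply: filterS3 nE nU PU => x nEx [L [_ PhiL LU]] PUx n.
rewrite /snrm /morph_op1 (PUx n L PhiL) /morph_opy LU nEx /normalized_section.
by rewrite linearZ nrmZ nrm_of_real ger0_norm ?invr_ge0 ?nrm_ge0// mulrC.
Qed.

(** Any common upper bound for the images of the normalized sections bounds the
    fiber norms. It is applied both to a competing upper bound in the lattice
    and to the constant operator norm. *)
Lemma fiber_norm_le_normalization (h : X -> \bar R) :
  (forall n, \forall y \ae mu, ((snrm (vsec
     (morph_opy phi Phi (normalization (vsec (U n))))) y)%:E <= h y)%E) ->
  \forall x \ae mu, (fiber_norm Phi x <= h (phi x))%E.
Proof.
move=> /ae_foralln/(ae_aut phi).
apply: filterS3 fiber_norm_sup snrm_morph_op_normalization => x -> e hx.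
by apply: ge_ereal_sup => _ [n _ <-]; rewrite -e.
Qed.

Lemma morph_abs_lub : measure_is_complete mu ->
  Linf_lub mu
    [set snrm (vsec (morph_opy phi Phi s))
    | s in [set s : Gammay E | \forall x \ae mu, snrm (vsec s) x <= 1]]
    (koopman phi (morph_abs Phi)).
Proof.
move=> cmu; split.
- by apply: Lfun_koopman; [rewrite leey|exact: morph_abs_Lfun].
- move=> _ [s s1 <-]; apply: (@ae_of_ae_aut _ _ _ _ phi).
  apply: filterS3 s1 (autK phi) (morph_op_abs_le s) => x sx xK /le_trans; apply.
  by rewrite /koopman /= xK ler_piMr// fine_ge0// fiber_norm_ge0.
- move=> h _ hub.
  have hPhi : \forall x \ae mu, (fiber_norm Phi x <= (h (phi x))%:E)%E.
    apply: (@fiber_norm_le_normalization (EFin \o h)) => n.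
    have unit_ball := snrm_normalization_le1 (vsec_meas (U n)).
    set s := normalization _ in unit_ball *.
    have /hub : [set snrm (vsec (morph_opy phi Phi s))
        | s in [set s : Gammay E | \forall x \ae mu, snrm (vsec s) x <= 1]]
        (snrm (vsec (morph_opy phi Phi s))) by exists s.
    by apply: filterS => y; rewrite lee_fin.
  apply: (@ae_of_ae_aut _ _ _ _ phi).
  apply: filterS3 hPhi fiber_norm_fin_num (autK phi) => x hx fx xK.
  by rewrite /koopman /= xK -lee_fin fineK.
Qed.

Lemma morph_norm_opnormy : morph_norm Phi = opnorm (morph_opy phi Phi).
Proof.
have M0 : 0 <= fine (morph_norm Phi) by rewrite fine_ge0 ?Lnorm_ge0.
apply/eqP; rewrite eq_le; apply/andP; split; last first.
  apply: ge_ereal_sup => _ [s /= s1 <-].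
  rewrite -(fineK morph_norm_fin_num) lee_fin; apply: Gammay_norm_le => //.
  apply: (@ae_of_ae_aut _ _ _ _ phi).
  apply: filterS2 (morph_op_norm_le s) (ae_le_Gammay_norm s) => x /le_trans h sx.
  by apply: h; rewrite ler_piMr// (le_trans sx).
apply: Lnormy_le; first exact: opnorm_ge0.
have /= := @fiber_norm_le_normalization (fun=> opnorm (morph_opy phi Phi)) _.
have H n : \forall y \ae mu, ((snrm (vsec
     (morph_opy phi Phi (normalization (vsec (U n))))) y)%:E <=
     opnorm (morph_opy phi Phi))%E.
  apply: filterS (ae_le_Gammay_norm (morph_opy phi Phi (normalization (vsec (U n)))))
    => y yn.
  apply: le_trans (opnorm_ubound (morph_opy phi Phi) (_ : nrm (normalization (vsec (U n))) <= 1)).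
    by rewrite lee_fin.
  by apply: Gammay_norm_le => //; apply: snrm_normalization_le1; exact: vsec_meas.
move=> /(_ H); apply: filterS => x.
by rewrite gee0_abs ?fiber_norm_ge0.
Qed.

Lemma measurable_snrm (G : bundle (k := k) mu) (v : Gamma1 G) :
  measurable_fun [set: X] (fun x => (snrm (vsec v) x)%:E).
Proof. by apply/measurable_EFinP; exact: vsec_mfun. Qed.

Lemma measurable_koopman_snrm (G : bundle (k := k) mu) (v : Gamma1 G) :
  measurable_fun [set: X] (fun y => (koopman phi (snrm (vsec v)) y)%:E).
Proof. exact: measurableT_comp (measurable_snrm v) (aut_inv_measurable phi). Qed.

Lemma integral_koopman_snrm (G : bundle (k := k) mu) (v : Gamma1 G) :
  (\int[mu]_y (koopman phi (snrm (vsec v)) y)%:E)%E = (nrm v)%:E.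
Proof.
rewrite -Gamma1_normE -[RHS](ge0_integral_koopman phi)//.
- exact: measurable_snrm.
- by move=> x; rewrite lee_fin nrm_ge0.
Qed.

Lemma nrm_morph_op1_le u : nrm (morph_op1 phi Phi u) <= fine (morph_norm Phi) * nrm u.
Proof.
have M0 : 0 <= fine (morph_norm Phi) by rewrite fine_ge0 ?Lnorm_ge0.
rewrite -lee_fin EFinM -Gamma1_normE -integral_koopman_snrm.
have k0 y : (0 <= (koopman phi (snrm (vsec u)) y)%:E)%E by rewrite lee_fin nrm_ge0.
have mk := measurable_koopman_snrm u.
rewrite -ge0_integralZl//; apply: ae_ge0_le_integral => //.
- by move=> x _; rewrite lee_fin nrm_ge0.
- exact: measurable_snrm.
- by move=> x _; rewrite mule_ge0.
- by apply: emeasurable_funM.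
apply: (@ae_of_ae_aut _ _ _ _ phi).
apply: filterS2 (morph_op_norm_le u) (autK phi) => x h xK _.
by rewrite -EFinM lee_fin /koopman/= xK.
Qed.

Section linear_operator.
Variable T : {linear Gamma1_module E -> Gamma1_module F}.
Hypothesis T_continuous : continuous T.
Hypothesis TPhi : T =1 morph_op1 phi Phi.

(** The L^1 operator norm controls the fibers pointwise, because [T] satisfies the
    intertwining relation. *)
Lemma snrm_morph_op_le_opnorm u : \forall x \ae mu,
  snrm (vsec (morph_op1 phi Phi u)) (phi x) <= fine (opnorm T) * snrm (vsec u) x.
Proof.
have Tlin := morph_op_koopman_linear TPhi.
have C0 : 0 <= fine (opnorm T) by rewrite fine_ge0 ?opnorm_ge0.
have := koopman_linear_le Tlin C0 (fun s => opnorm_bound s T_continuous) u.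
move=> /(ae_aut phi); apply: filterS2 (autK phi) => x xK.
by rewrite /= TPhi /koopman /= xK.
Qed.

(** The operator norm over L^1 sections bounds the fiber maps on the dense values
    of the [U n], hence on whole fibers. *)
Lemma morph_norm_opnorm1 : morph_norm Phi = opnorm (morph_op1 phi Phi).
Proof.
have TE : opnorm T = opnorm (morph_op1 phi Phi).
  by rewrite /opnorm; congr ereal_sup; apply/seteqP; split => _ [v v1 <-];
    exists v => //; rewrite TPhi.
have M0 : 0 <= fine (morph_norm Phi) by rewrite fine_ge0 ?Lnorm_ge0.
have C0 : 0 <= fine (opnorm T) by rewrite fine_ge0 ?opnorm_ge0.
apply/eqP; rewrite eq_le; apply/andP; split; last first.
  by rewrite -(fineK morph_norm_fin_num); apply: opnorm_le => //; exact: nrm_morph_op1_le.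
rewrite -TE; apply: Lnormy_le; first exact: opnorm_ge0.
have TU := ae_foralln (fun n => snrm_morph_op_le_opnorm (U n)).
apply: filterS3 U_dense TU (premorphism_apply_seq U PhiP).
move=> x Ux TUx [L [Lc PhiL LU]].
rewrite gee0_abs ?fiber_norm_ge0// (fiberwise_norm PhiL).
rewrite -(fineK (opnorm_fin_num T_continuous)); apply: opnorm_le => //.
by apply: (linear_le_dense Ux) => // n; rewrite -LU; exact: TUx.
Qed.

(** An isometric [T] satisfies both [koopman_linear_le] and [koopman_linear_ge]
    with constant one, which makes the fiber maps isometric on a dense set. *)
Lemma morph_isometricP : morph_isometric Phi <-> isometric (morph_op1 phi Phi).
Proof.
split=> [Phi_iso u|T_iso].
  rewrite !nrmE; congr of_real; apply: EFin_inj.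
  rewrite -Gamma1_normE -integral_koopman_snrm.
  apply: ge0_ae_eq_integral => //.
  - exact: measurable_snrm.
  - exact: measurable_koopman_snrm.
  - by move=> x _; rewrite lee_fin nrm_ge0.
  - by move=> x _; rewrite lee_fin nrm_ge0.
  apply: (@ae_of_ae_aut _ _ _ _ phi).
  have snrm_iso : \forall x \ae mu,
      snrm (vsec (morph_op1 phi Phi u)) (phi x) = snrm (vsec u) x.
    apply: filterS3 (premorphism_apply u PhiP) (premorphism_fiberwise PhiP) Phi_iso.
    by move=> x H [L [_ PhiL]] iso; rewrite /snrm /morph_op1 (H L PhiL) -iso PhiL.
  by apply: filterS2 snrm_iso (autK phi) => x e xK _; rewrite /koopman/= xK e.
have Tlin := morph_op_koopman_linear TPhi.
have nT u : nrm (T u) = nrm u by rewrite TPhi /nrm T_iso.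
have Tle s : nrm (T s) <= 1 * nrm s by rewrite nT mul1r.
have Tge s : nrm s <= nrm (T s) by rewrite nT.
have TU : \forall x \ae mu, forall n,
    nrm (vsec (morph_op phi Phi (U n)) (phi x)) = nrm (vsec (U n) x).
  apply: ae_foralln => n.
  apply: filterS3 (autK phi) (ae_aut phi (koopman_linear_le Tlin ler01 Tle (U n)))
    (ae_aut phi (koopman_linear_ge Tlin Tge (U n))) => x xK.
  rewrite TPhi mul1r /koopman /= xK => le ge.
  by apply/eqP; rewrite eq_le le ge.
apply: filterS3 U_dense TU (premorphism_apply_seq U PhiP).
move=> x Ux TUx [L [Lc PhiL LU]] v; rewrite PhiL; apply/eqP; rewrite eq_le.
apply/andP; split.
  rewrite -[leRHS]mul1r; apply: (linear_le_dense Ux) => // n.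
  by rewrite mul1r -LU TUx.
apply: (linear_ge_dense Ux) => // n.
by rewrite -LU TUx.
Qed.

End linear_operator.

End morphism_norms.

(** * The morphism inducing a dominated operator *)

Section construction.
Context {R : realType} {k : scalar_kind}.
Local Notation K := (scalars R k).
Context {d : measure_display} {X : measurableType d}.
Variable mu : {measure set X -> \bar R}.
Hypothesis mu_sigma_finite : sigma_finite [set: X] mu.
Variable phi : automorphism mu.
Variables E F : bundle (k := k) mu.
Variable U : nat -> Gamma1 E.
Hypothesis U_dense : \forall x \ae mu, dense (range (fun n => vsec (U n) x)).
Variable T : {linear Gamma1_module E -> Gamma1_module F}.

Lemma vsecB p (p1 : (1 <= p)%E) (G : bundle (k := k) mu) (v w : Gamma p1 G) :
  \forall x \ae mu, vsec (v - w) x = vsec v x - vsec w x.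
Proof. by apply: filterS2 (vsecD v (- w)) (vsecN w) => x -> ->. Qed.

Lemma vsec_lincomb p (p1 : (1 <= p)%E) (G : bundle (k := k) mu) (a : K)
    (u v w : Gamma p1 G) :
  \forall x \ae mu, vsec (a *: u + (v - w)) x = a *: vsec u x + (vsec v x - vsec w x).
Proof.
by apply: filterS3 (vsecD (a *: u) (v - w)) (vsecZ a u) (vsecB v w) => x -> -> ->.
Qed.

(** Domination read at [phi x] instead of at a generic point, which is the form
    in which it relates the fibers over [x] and [phi x]. *)
Definition pointwise_dominated (m : R) : Prop := forall u : Gamma1 E,
  \forall x \ae mu, snrm (vsec (T u)) (phi x) <= m * snrm (vsec u) x.

Lemma koopman_pointwise_dominated (m : R) :
  (forall u, \forall y \ae mu, lm_abs (T u) y <= m * koopman phi (lm_abs u) y) ->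
  pointwise_dominated m.
Proof.
by move=> Tm u; apply: filterS2 (autK phi) (ae_aut phi (Tm u)) => x xK;
  rewrite /koopman /= xK.
Qed.

(** Rational scalars and triples of indices form a countable set, so the
    inequalities needed for the extension hold simultaneously almost everywhere. *)
Lemma koopman_dominated_fibers (m : R) : 0 <= m ->
  pointwise_dominated m ->
  \forall x \ae mu, exists L : {linear fiber E x -> fiber F (phi x)},
    (forall v, nrm (L v) <= m * nrm v) /\
    forall v w, (forall n, nrm (w - vsec (T (U n)) (phi x)) <= m * nrm (v - vsec (U n) x)) ->
      L v = w.
Proof.
move=> m0 Tm.
have Tcomb : \forall x \ae mu, forall t : (rat * rat) * (nat * nat * nat),
    let a := @rational_scalar R k t.1 in
    let: (i, j, l) := t.2 in
    nrm (a *: vsec (T (U i)) (phi x) +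
         (vsec (T (U j)) (phi x) - vsec (T (U l)) (phi x))) <=
    m * nrm (a *: vsec (U i) x + (vsec (U j) x - vsec (U l) x)).
  apply: ae_forall_countable => -[q [[i j] l]] /=.
  set a := rational_scalar q.
  have := vsec_lincomb a (T (U i) : Gamma1 F) (T (U j)) (T (U l)).
  move=> /(ae_aut phi).
  apply: filterS3 (Tm (a *: U i + (U j - U l))) (vsec_lincomb a (U i) (U j) (U l)) => x.
  rewrite linearD linearB linearZ /snrm /= => h e e'.
  by rewrite e e' in h.
apply: filterS2 U_dense Tcomb => x Ux H.
apply: (dense_linear_extension m0 Ux) => a i j l.
rewrite -!addrA; apply: ler_rational_scalar => // q.
exact: (H (q, (i, j, l))).
Qed.

(** The chosen fiber maps depend on [x] without any regularity, but [LT] says that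
    they send integrable sections to representatives of their images under [T].
    A general measurable section is an integrable one times a measurable
    function. *)
Lemma koopman_dominated_morphism : koopman_dominated phi T ->
  exists2 Phi, premorphism phi Phi & T =1 morph_op1 phi Phi.
Proof.
case=> m /ltW m0 /koopman_pointwise_dominated Tm.
pose spec x (L : {linear fiber E x -> fiber F (phi x)}) :=
  (forall v, nrm (L v) <= m * nrm v) /\
    forall v w, (forall n, nrm (w - vsec (T (U n)) (phi x)) <= m * nrm (v - vsec (U n) x)) ->
      L v = w.
(* Where no suitable fiber map exists the zero map is taken. *)
have pick_L x : {L : {linear fiber E x -> fiber F (phi x)} |
    (exists L', @spec x L') -> @spec x L}.
  have [ex|nex] := pselect (exists L', @spec x L').
    by exists (sval (cid ex)) => _; exact: svalP (cid ex).
  by exists \0 => /nex.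
pose L x := sval (pick_L x).
have LP : \forall x \ae mu, @spec x (L x).
  by apply: filterS (koopman_dominated_fibers m0 Tm) => x; exact: svalP (pick_L x).
have LT (u : Gamma1 E) : \forall x \ae mu, L x (vsec u x) = vsec (T u) (phi x).
  have uU : \forall x \ae mu, forall n,
      nrm (vsec (T u) (phi x) - vsec (T (U n)) (phi x)) <=
      m * nrm (vsec u x - vsec (U n) x).
    apply: ae_foralln => n.
    apply: filterS3 (Tm (u - U n)) (vsecB u (U n))
      (ae_aut phi (vsecB (T u : Gamma1 F) (T (U n)))) => x.
    by rewrite linearB /snrm /= => h e e'; rewrite e e' in h.
  by apply: filterS2 LP uU => x [_ uniq] /uniq.
pose Phi (e : Defs.total E) : Defs.total F :=
  existT _ (phi (projT1 e)) (L (projT1 e) (projT2 e)).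
have PhiP : premorphism phi Phi.
  split.
  - move=> s ms; have [r [mr r0 rsP]] := integrable_rescaling mu_sigma_finite ms.
    set rs := (fun x => _) in rsP.
    pose u : Gamma1 E := cls (@lexx _ _ 1%E) rs.
    pose g x := of_real k (r x)^-1.
    have mg : Kmeasurable (koopman phi g).
      apply: Kmeasurable_comp; first exact: aut_inv_measurable.
      by apply: Kmeasurable_of_real; apply: ge0_measurable_funV => // x; exact: ltW.
    (* The section [s] is [g] times [u], so its image is [T u] times the
       transported factor. *)
    exists (fun y => koopman phi g y *: vsec (T u) y).
      by apply: msecM => //; exact: vsec_meas.
    apply: filterS3 (vsec_cls rsP) (LT u) (autK phi) => x us Lu xK.
    rewrite /Phi /koopman /= xK -Lu us /rs linearZ scalerA /g -of_realM.
    by rewrite mulVf ?of_real1 ?scale1r// gt_eqF.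
  - exact: nearW.
  - apply: filterS LP => x [Lm _]; exists (L x); split => //.
    exact: bounded_continuous Lm.
  - apply: (@le_lt_trans _ _ m%:E); last exact: ltry.
    apply: Lnormy_le; first by rewrite lee_fin.
    apply: filterS LP => x [Lm _].
    rewrite gee0_abs ?fiber_norm_ge0//.
    by rewrite (@fiberwise_norm _ _ _ _ _ phi E F Phi x (L x))// opnorm_le.
exists Phi => // u; apply: vsec_inj; apply: (@ae_of_ae_aut _ _ _ _ phi).
apply: filterS2 (LT u) (premorphism_apply u PhiP) => x e H.
by rewrite -[RHS]/(vsec (morph_op phi Phi u) (phi x)) (H (L x)).
Qed.

End construction.

(** * The characterization *)

Theorem theorem5p16 (R : realType) (k : scalar_kind) (d : measure_display)
    (X : measurableType d) (mu : {sigma_finite_measure set X -> \bar R})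
    (cmu : measure_is_complete mu) (phi : automorphism mu) :
  (forall (G L : L1_module (k := k) mu) (T : {linear G -> L}), continuous T ->
    [<-> koopman_linear phi T;
         koopman_opnorm_dominated phi T;
         koopman_dominated phi T]) /\
  (forall (E F : bundle (k := k) mu), separable_bundle E ->
    forall T : {linear Gamma1_module E -> Gamma1_module F}, continuous T ->
    [<-> koopman_linear phi T;
         koopman_opnorm_dominated phi T;
         koopman_dominated phi T;
         exists2 Phi, premorphism phi Phi & T =1 morph_op1 phi Phi] /\
    forall Phi, premorphism phi Phi -> T =1 morph_op1 phi Phi ->
    [/\ forall Phi', premorphism phi Phi' -> T =1 morph_op1 phi Phi' ->
          morph_eq Phi Phi',
        morph_abs Phi \in Lfun mu +oo%E,
        Linf_lub mu
          [set snrm (vsec (morph_opy phi Phi s))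
          | s in [set s : Gammay E | \forall x \ae mu, snrm (vsec s) x <= 1]]
          (koopman phi (morph_abs Phi)),
        morph_norm Phi = opnorm (morph_opy phi Phi) /\
        opnorm (morph_opy phi Phi) = opnorm (morph_op1 phi Phi)
      & morph_isometric Phi <-> isometric (morph_op1 phi Phi)]).
Proof.
have part1 (G L : L1_module (k := k) mu) (T : {linear G -> L}) : continuous T ->
    [<-> koopman_linear phi T; koopman_opnorm_dominated phi T; koopman_dominated phi T].
  move=> Tc; tfae.
  - exact: koopman_linear_opnorm_dominated.
  - exact: koopman_opnorm_dominated_dominated.
  - exact: koopman_dominated_linear.
split => // E F E_sep T Tc.
have mu_sf : sigma_finite [set: X] mu by exact: sigma_finiteT.
have [U U_dense] := separable_dense_sequence mu_sf E_sep.
split.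
  have abc := part1 _ _ T Tc; tfae.
  - exact: (abc 0%N 1%N).1.
  - exact: (abc 1%N 2%N).1.
  - exact: (koopman_dominated_morphism mu_sf U_dense).
  - by case=> Phi PhiP; exact: morph_op_koopman_linear.
move=> Phi PhiP TPhi; split.
- move=> Phi' PhiP' TPhi'; apply: (morph_op_inj U_dense PhiP PhiP') => n.
  by rewrite -TPhi -TPhi'.
- exact: (morph_abs_Lfun U_dense PhiP cmu).
- exact: (morph_abs_lub U_dense PhiP cmu).
- by rewrite -(morph_norm_opnormy U_dense PhiP) -(morph_norm_opnorm1 U_dense PhiP Tc TPhi).
- exact: (morph_isometricP U_dense PhiP TPhi).
Qed.
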